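(* Let $K\in L^2(0,2\pi)$ and let $\lambda\in\sigma(P_{1,K})$. Then the algebraic multiplicity $m_a(\lambda,P_{1,K})$ of $\lambda$ is equal to the multiplicity of $\lambda$ as a root of the entire function $$\Phi(\lambda)=1-e^{2\pi i\lambda}-\int_0^{2\pi}e^{i\lambda t}(-iK(t))\,dt .$$
   Context: For $K\in L^2(0,2\pi)$ (complex-valued), the operator $P_{1,K}$ in $L^2(0,2\pi)$ is defined by $$\mathrm{dom}(P_{1,K})=\{f\in H^1(0,2\pi)\mid f(0)=f(2\pi)\},\qquad (P_{1,K}f)(x)=if'(x)+f(2\pi)K(x).$$ For an operator $A$ in a Hilbert space and an eigenvalue $\lambda$ of $A$, the root space is $\mathcal{R}(\lambda,A)=\{f\mid\exists j\in\mathbb{N}\text{ such that }(A-\lambda)^jf=0\}$, and the algebraic multiplicity is $m_a(\lambda,A)=\dim\mathcal{R}(\lambda,A)$. The spectrum $\sigma(P_{1,K})$ consists only of eigenvalues and equals the zero set of $\Phi$. *)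

(* Defs.v *)
From HB Require Import structures.
From mathcomp Require Import all_boot all_order all_algebra complex.
From mathcomp Require Import ring_quotient ring.
From mathcomp Require Import all_classical all_reals all_analysis.
From mathcomp Require Import measurable_realfun.
Set Implicit Arguments.
Unset Strict Implicit.
Unset Printing Implicit Defensive.
Import Order.TTheory GRing.Theory Num.Theory.
Import numFieldNormedType.Exports ComplexField.Normc.
Local Open Scope classical_set_scope.
Local Open Scope ring_scope.
Local Open Scope complex_scope.
Local Open Scope quotient_scope.

(* Complex numbers are written R[i]^o rather than R[i]: the regular module
   carries the normed topology and the scaling by complex numbers, whereas
   MathComp's canonical module structure on R[i] itself is the real one. *)

Section ComplexFunctions.
Variable R : realType.
Local Notation C := (R[i]^o).
Local Notation mu := (@lebesgue_measure R).

Definition I02pi : set R := `]0, 2 * pi[.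

Definition cintegral (f : R -> C) : C :=
  (\int[mu]_(x in I02pi) complex.Re (f x))
    +i* (\int[mu]_(x in I02pi) complex.Im (f x)).

Definition cexp (z : C) : C :=
  (expR (complex.Re z) * cos (complex.Im z))
    +i* (expR (complex.Re z) * sin (complex.Im z)).

Definition sq_integrable (f : R -> C) : Prop :=
  [/\ measurable_fun I02pi (fun x => complex.Re (f x)),
      measurable_fun I02pi (fun x => complex.Im (f x)) &
      (\int[mu]_(x in I02pi) (normc (f x) ^+ 2)%:E < +oo)%E].

Definition sqint : {pred R -> C} := fun f => `[< sq_integrable f >].

Let mI : measurable I02pi. Proof. exact: measurable_itv. Qed.

Lemma sq_normc (z : C) :
  normc z ^+ 2 = complex.Re z ^+ 2 + complex.Im z ^+ 2.
Proof. by case: z => a b /=; rewrite sqr_sqrtr// addr_ge0// sqr_ge0. Qed.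

Lemma measurable_sq_normc (f : R -> C) :
  measurable_fun I02pi (fun x => complex.Re (f x)) ->
  measurable_fun I02pi (fun x => complex.Im (f x)) ->
  measurable_fun I02pi (EFin \o (fun x => normc (f x) ^+ 2 : R)).
Proof.
move=> mr mi; apply/measurable_EFinP.
rewrite (_ : (fun _ => _) =
  (fun x => complex.Re (f x) ^+ 2 + complex.Im (f x) ^+ 2)).
  by apply: measurable_funD; apply: measurable_funX.
by apply/funext => x; exact: sq_normc.
Qed.

Lemma sqint_submod_closed : submod_closed sqint.
Proof.
split.
  apply/asboolP; split; [exact: measurable_cst|exact: measurable_cst|].
  rewrite (eq_integral (cst 0%E)) ?integral0 ?ltry// => x _.
  by rewrite [normc _]normc0 expr0n.
move=> c f g /asboolP[frm fim fi] /asboolP[grm gim gi].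
have cfgE x : (c *: f + g) x = (c : R[i]) * (f x : R[i]) + (g x : R[i]) by [].
have hrm : measurable_fun I02pi (fun x => complex.Re ((c *: f + g) x)).
  rewrite (_ : (fun _ => _) = (fun x =>
    (complex.Re c * complex.Re (f x) - complex.Im c * complex.Im (f x))
      + complex.Re (g x))).
    apply: measurable_funD => //; apply: measurable_funB.
      exact: measurable_funM.
    exact: measurable_funM.
  apply/funext => x; rewrite cfgE.
  by case: c (f x) (g x) {cfgE} => [c1 c2] [f1 f2] [g1 g2].
have him : measurable_fun I02pi (fun x => complex.Im ((c *: f + g) x)).
  rewrite (_ : (fun _ => _) = (fun x =>
    (complex.Re c * complex.Im (f x) + complex.Im c * complex.Re (f x))
      + complex.Im (g x))).
    apply: measurable_funD => //; apply: measurable_funD.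
      exact: measurable_funM.
    exact: measurable_funM.
  apply/funext => x; rewrite cfgE.
  by case: c (f x) (g x) {hrm cfgE} => [c1 c2] [f1 f2] [g1 g2].
apply/asboolP; split => //.
pose k : R := 2 * normc c ^+ 2.
have k0 : 0 <= k by rewrite mulr_ge0// sqr_ge0.
apply: (@le_lt_trans _ _ (\int[mu]_(x in I02pi)
   (k%:E * (normc (f x) ^+ 2)%:E + 2%:E * (normc (g x) ^+ 2)%:E))%E).
  apply: ge0_le_integral => //.
  - by move=> x _; rewrite lee_fin sqr_ge0.
  - exact: measurable_sq_normc.
  - apply: emeasurable_funD; apply: emeasurable_funM;
      solve [exact: measurable_cst | exact: measurable_sq_normc].
  - move=> x _; rewrite -!EFinM -EFinD lee_fin /k !sq_normc cfgE.
    case: c (f x) (g x) {k k0 hrm him cfgE} => [c1 c2] [f1 f2] [g1 g2] /=.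
    set a := c1 * f1 - c2 * f2; set b := c1 * f2 + c2 * f1.
    have -> : 2 * (c1 ^+ 2 + c2 ^+ 2) * (f1 ^+ 2 + f2 ^+ 2)
        = 2 * (a ^+ 2 + b ^+ 2).
      by rewrite /a /b; ring.
    rewrite -subr_ge0.
    have -> : 2 * (a ^+ 2 + b ^+ 2) + 2 * (g1 ^+ 2 + g2 ^+ 2)
        - ((a + g1) ^+ 2 + (b + g2) ^+ 2) = (a - g1) ^+ 2 + (b - g2) ^+ 2.
      by ring.
    by rewrite addr_ge0// sqr_ge0.
have nn (h : R -> C) x : I02pi x -> (0 <= (normc (h x) ^+ 2)%:E)%E.
  by rewrite lee_fin sqr_ge0.
rewrite ge0_integralD//; last 4 first.
- by move=> x Ix; rewrite mule_ge0// nn.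
- by apply: emeasurable_funM; solve [exact: measurable_cst | exact: measurable_sq_normc].
- by move=> x Ix; rewrite mule_ge0// nn.
- by apply: emeasurable_funM; solve [exact: measurable_cst | exact: measurable_sq_normc].
rewrite !ge0_integralZl//; last 4 first.
- exact: measurable_sq_normc.
- exact: nn.
- exact: measurable_sq_normc.
- exact: nn.
by rewrite lte_add_pinfty// lte_mul_pinfty// lee_fin.
Qed.

HB.instance Definition _ :=
  GRing.isSubmodClosed.Build _ _ sqint sqint_submod_closed.

Record L2fun := MkL2fun { L2fun_val :> R -> C; _ : L2fun_val \in sqint }.

HB.instance Definition _ := [isSub for L2fun_val].
HB.instance Definition _ := [Choice of L2fun by <:].
HB.instance Definition _ := [SubChoice_isSubLmodule of L2fun by <:].

Definition ae_null : {pred L2fun} :=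
  fun f => `[< {ae mu, forall x, I02pi x -> f x = 0} >].

Lemma ae_null_submod_closed : submod_closed ae_null.
Proof.
split.
  by apply/asboolP; apply: aeW => x _.
move=> c f g /asboolP f0 /asboolP g0; apply/asboolP.
have F := @ae_filter_ringOfSetsType _ _ _ mu.
apply: (@filterS2 _ _ F _ _ _ _ f0 g0) => x fx gx Ix.
rewrite /= -[LHS]/(c *: (f x : C) + g x) fx// gx//.
by rewrite scaler0 addr0.
Qed.

HB.instance Definition _ :=
  GRing.isSubmodClosed.Build _ _ ae_null ae_null_submod_closed.

Definition L2 : Type := Quotient.quot ae_null.
HB.instance Definition _ := Choice.on L2.
HB.instance Definition _ := EqQuotient.on L2.
HB.instance Definition _ := GRing.Zmodule.on L2.

Definition L2scale (c : R[i]) (u : L2) : L2 := \pi_L2 (c *: repr u).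

Lemma pi_L2scale (c : R[i]) (f : L2fun) :
  L2scale c (\pi_L2 f) = \pi_L2 (c *: f).
Proof.
apply/eqP; rewrite -Quotient.idealrBE -scalerBr rpredZ//.
by rewrite Quotient.idealrBE reprK.
Qed.

Lemma pi_L2D (f g : L2fun) : \pi_L2 (f + g) = \pi_L2 f + \pi_L2 g.
Proof. exact: (@Quotient.pi_add _ ae_null). Qed.

Lemma L2P (u : L2) : exists f, u = \pi_L2 f.
Proof. by exists (repr u); rewrite reprK. Qed.

Lemma L2scaleA a b u : L2scale a (L2scale b u) = L2scale (a * b) u.
Proof. by case: (L2P u) => f ->; rewrite !pi_L2scale scalerA. Qed.

Lemma L2scale1 : left_id 1 L2scale.
Proof. by move=> u; case: (L2P u) => f ->; rewrite pi_L2scale scale1r. Qed.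

Lemma L2scaleDr : right_distributive L2scale +%R.
Proof.
move=> c u v; case: (L2P u) (L2P v) => f -> [g ->].
by rewrite -pi_L2D !pi_L2scale scalerDr pi_L2D.
Qed.

Lemma L2scaleDl u : {morph L2scale^~ u : a b / a + b}.
Proof.
by move=> a b /=; case: (L2P u) => f ->; rewrite !pi_L2scale scalerDl pi_L2D.
Qed.

HB.instance Definition _ := GRing.Zmodule_isLmodule.Build R[i] L2
  L2scaleA L2scale1 L2scaleDr L2scaleDl.

Definition L2_to_fun (u : L2) : R -> C := repr u.
Coercion L2_to_fun : L2 >-> Funclass.

Definition L2norm (u : L2) : R :=
  Num.sqrt (\int[mu]_(x in I02pi) (normc (u x) ^+ 2)).

End ComplexFunctions.

Section UnboundedOperators.
Variables (K : fieldType) (V : lmodType K).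

(* The values of [op_app] outside [dom] are irrelevant. *)
Record operator := Operator { dom : set V; op_app :> V -> V }.

Definition op_shift (A : operator) (z : K) : operator :=
  Operator (dom A) (fun u => A u - z *: u).

Definition op_pow (A : operator) (j : nat) : operator :=
  Operator [set u | forall i, (i < j)%N -> dom A (iter i A u)] (iter j A).

(* j = 0 only contributes the zero vector. *)
Definition root_space (A : operator) (z : K) : set V :=
  [set u | exists j : nat,
     dom (op_pow (op_shift A z) j) u /\ op_pow (op_shift A z) j u = 0].

Definition has_dim (S : set V) (n : nat) : Prop :=
  exists e : 'I_n -> V,
    (forall c : 'I_n -> K, \sum_(i < n) c i *: e i = 0 -> forall i, c i = 0)
    /\ S = [set \sum_(i < n) c i *: e i | c in [set: 'I_n -> K]].

Definition alg_multiplicity_is (A : operator) (z : K) (m : nat) : Prop :=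
  has_dim (root_space A z) m.

End UnboundedOperators.

Section OperatorP.
Variable R : realType.
Local Notation C := (R[i]^o).
Local Notation mu := (@lebesgue_measure R).
Local Notation L2 := (L2 R).

Definition resolvent_set (A : operator L2) : set R[i] :=
  [set z | set_bij (dom A) setT (op_shift A z) /\
     exists M : R, forall u, dom A u -> L2norm u <= M * L2norm (op_shift A z u)].

Definition spectrum (A : operator L2) : set R[i] := ~` resolvent_set A.

(* Compactly supported C^1 functions on the open interval; C^oo ones would
   determine the same weak derivatives. *)
Definition test_function (phi : R -> R) : Prop :=
  [/\ forall x, derivable phi x 1, continuous (phi^`())%classic &
      exists a b : R, [/\ 0 < a, b < 2 * pi &
        forall x, ~~ (a <= x <= b) -> phi x = 0]].

Definition weak_derivative (u v : L2) : Prop :=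
  forall phi : R -> R, test_function phi ->
    cintegral (fun x => u x * ((phi^`())%classic x)%:C)
      = - cintegral (fun x => v x * (phi x)%:C).

Definition H1 : set L2 := [set u | exists v, weak_derivative u v].

Definition deriv_L2 (u : L2) : L2 := xget 0 [set v | weak_derivative u v].

Definition cont_rep (u : L2) : set (R -> C) :=
  [set f | {within `[0, 2 * pi], continuous f} /\
           {ae mu, forall x, I02pi x -> f x = u x}].

Definition val_2pi (u : L2) : C := xget (cst 0) (cont_rep u) (2 * pi).

(* Boundary values of an element of H^1 are those of its continuous
   representative. *)
Definition P1 (K : L2) : operator L2 :=
  Operator
    [set u | H1 u /\ exists2 f, cont_rep u f & f 0 = f (2 * pi)]
    (fun u => 'i *: deriv_L2 u + val_2pi u *: K).

Definition Phi (K : L2) (z : C) : C :=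
  1 - cexp ((2 * pi)%:C * 'i * z)
    - cintegral (fun t => cexp ('i * z * t%:C) * (- 'i * K t)).

(* Order of vanishing, for F holomorphic near z: elsewhere derive1n is a limit
   that need not exist. *)
Definition root_multiplicity_is (F : C -> C) (z : C) (m : nat) : Prop :=
  (forall k, (k < m)%N -> (F^`(k))%classic z = 0) /\ (F^`(m))%classic z != 0.

End OperatorP.

(* Main.v *)
(* Put e(t) = exp(i lam t).  Variation of constants shows that (P1 - lam) u = h
   with u(2 pi) = c holds iff e u = W on ]0, 2 pi[ and W(2 pi) = e(2 pi) c, where
     W(x) = c + int_0^x i e (c K - h).
   For c = 1, h = 0 this W is called w_0, and w_{j+1}(x) = - i int_0^x w_j.  As
   long as w_0(2 pi) = e(2 pi) and w_1(2 pi) = ... = w_{m-1}(2 pi) = 0, the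
   functions w_j / e, j < m, form a Jordan chain of P1 at lam; if m is the first
   index at which this condition fails, the chain cannot be extended and spans
   the root space.  Repeated integration by parts identifies the defect of
   index j with (- i)^j / j! times the value at (2 pi - t)^j of the functional
     p |-> p(0) - p(2 pi) e(2 pi) + i int_0^{2 pi} p e K,
   whose value at t^k is, up to the factor i^k, the k-th derivative of Phi at
   lam.  The two families of polynomials being triangularly related, m is also
   the order of vanishing of Phi at lam. *)
Require Import Defs.
From mathcomp Require Import all_boot all_order all_algebra complex.
From mathcomp Require Import ring_quotient ring lra.
From mathcomp Require Import all_classical all_reals all_analysis.
From mathcomp Require Import measurable_realfun.
Set Implicit Arguments.
Unset Strict Implicit.
Unset Printing Implicit Defensive.
Import Order.TTheory GRing.Theory Num.Theory.
Import numFieldNormedType.Exports ComplexField.Normc.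
Local Open Scope classical_set_scope.
Local Open Scope ring_scope.
Local Open Scope complex_scope.

(** * Primitives of integrable functions on the real line *)

Section RealPrimitives.
Variable R : realType.
Local Notation mu := (@lebesgue_measure R).
Implicit Types (f g v E F : R -> R) (a b c T x y : R).

(** The term f(2 pi) K couples the equation to an unknown boundary value. Once that value is an
    independent parameter c, what remains is a first-order initial value problem, and periodicity
    becomes a single scalar closing condition. Since c is the only freedom left in the homogeneous
    equation, one chain suffices to span the root space. As K is merely square integrable, solutions
    are only absolutely continuous. Derivatives are therefore replaced by the relation F x = F 0 +
    (primitive of an integrable density), and weak derivatives are brought to this form by the lemma
    of du Bois-Reymond. The powers (2 pi - t)^j come from Cauchy's formula for repeated integration
    up to the end point 2 pi. The derivatives of Phi are computed from a remainder bound for exp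
    that is uniform on [0, 2 pi], so no theorem on differentiation under the integral sign is
    involved. *)

Definition prim g x : R := \int[mu]_(t in `]0, x[) g t.

Lemma integrable_oo_sub a b c d g : a <= c -> d <= b ->
  mu.-integrable `]a, b[ (EFin \o g) -> mu.-integrable `]c, d[ (EFin \o g).
Proof.
move=> ac db; apply: integrableS => //; apply: subset_itv; by rewrite bnd_simp.
Qed.

Lemma integrable_oo_cc a b g :
  mu.-integrable `]a, b[ (EFin \o g) -> mu.-integrable `[a, b] (EFin \o g).
Proof.
move=> /integrableP[mg ig]; apply/integrableP; split.
  exact: emeasurable_fun_itv_cc mg.
by rewrite integral_itv_bndoo//; exact: measurableT_comp.
Qed.

Lemma within_continuous_bounded a b f : a <= b ->
  {within `[a, b], continuous f} ->
  exists2 M, 0 <= M & forall x, a <= x <= b -> `|f x| <= M.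
Proof.
move=> ab cf.
have cf' : {within `[a, b], continuous (fun x => `|f x|)}.
  by move=> x; apply: continuous_comp; [exact: cf|exact: norm_continuous].
have [c _ cM] := EVT_max ab cf'.
by exists `|f c| => // x xab; apply: cM; rewrite in_itv.
Qed.

Lemma continuous_integrable_oo a b f :
  {within `[a, b], continuous f} -> mu.-integrable `]a, b[ (EFin \o f).
Proof.
move=> cf; apply: (@integrableS _ _ _ mu `[a, b]) => //.
  exact: subset_itv_oo_cc.
by apply: continuous_compact_integrable => //; exact: segment_compact.
Qed.

Lemma continuous_measurable_oo a b f :
  {within `[a, b], continuous f} -> measurable_fun `]a, b[ f.
Proof. by move/continuous_integrable_oo/measurable_int/measurable_EFinP. Qed.

Lemma integrableM_continuous a b f g :
  {within `[a, b], continuous f} -> mu.-integrable `]a, b[ (EFin \o g) ->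
  mu.-integrable `]a, b[ (EFin \o (fun x => f x * g x)).
Proof.
have [ab|ba] := leP a b; last first.
  move=> _ _; rewrite set_itv_ge ?bnd_simp ?le_gtF ?ltW//.
  exact: integrable_set0.
move=> cf ig.
have [M M0 fM] := within_continuous_bounded ab cf.
have := @integrableMr _ _ _ mu `]a, b[ _ f (EFin \o g); apply => //.
  exact: continuous_measurable_oo.
exists M; split; first exact: num_real.
move=> r Mr x /=; rewrite in_itv/= => /andP[ax xb].
by rewrite (le_trans (fM _ _)) ?(ltW ax) ?(ltW xb)// ltW.
Qed.

Lemma prim0 g : prim g 0 = 0.
Proof. by rewrite /prim set_itvoo0 Rintegral_set0. Qed.

Lemma Rintegral_oo_split g a b c : a <= b -> b <= c ->
  mu.-integrable `]a, c[ (EFin \o g) ->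
  \int[mu]_(t in `]a, c[) g t =
    \int[mu]_(t in `]a, b[) g t + \int[mu]_(t in `]b, c[) g t.
Proof.
move=> ab bc ig.
have [->|nbc] := eqVneq b c.
  by rewrite [in X in _ = _ + X]set_itvoo0 Rintegral_set0 addr0.
have {nbc} bc' : b < c by rewrite lt_neqAle nbc.
rewrite [X in _ = X + _]Rintegral_itv_bndo_bndc; last first.
  exact: integrable_oo_sub ig.
have := @Rintegral_itvB R g (BRight a) (BLeft c) b ig.
by rewrite !bnd_simp => /(_ ab bc') <-; rewrite addrC subrK.
Qed.

Lemma primB T g x y : 0 <= x -> x <= y -> y <= T ->
  mu.-integrable `]0, T[ (EFin \o g) ->
  prim g y - prim g x = \int[mu]_(t in `]x, y[) g t.
Proof.
move=> x0 xy yT ig.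
rewrite /prim (@Rintegral_oo_split g 0 x y)//; last first.
  exact: integrable_oo_sub ig.
by rewrite addrC addKr.
Qed.

Lemma prim_continuous T g : 0 <= T ->
  mu.-integrable `]0, T[ (EFin \o g) ->
  {within `[0, T], continuous (prim g)}.
Proof.
move=> T0 ig.
have := parameterized_integral_continuous T0 (integrable_oo_cc ig).
apply: subspace_eq_continuous => x; rewrite inE/= in_itv/= => /andP[x0 xT].
have igx : mu.-integrable `]0, x[ (EFin \o g) by exact: integrable_oo_sub ig.
rewrite /from_subspace /parameterized_integral /prim /= -Rintegral_itv_obnd_cbnd.
  by rewrite -Rintegral_itv_bndo_bndc.
apply: integrableS (integrable_oo_cc igx) => //.
by apply: subset_itv; rewrite bnd_simp.
Qed.

(* Splitting [0, x] into n equal steps bounds |G x - G 0| by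
   c (x / n) (Q x - Q 0), for every n. *)
Lemma eq_of_quadratic_increment (G Q : R -> R) c T :
  (forall x y, 0 <= x -> x <= y -> y <= T ->
    `|G y - G x| <= c * (y - x) * (Q y - Q x)) ->
  forall x, 0 <= x <= T -> G x = G 0.
Proof.
move=> GQ x /andP[x0 xT].
pose K := c * x * (Q x - Q 0).
have step n : `|G x - G 0| *+ n.+1 <= K.
  pose d := x / n.+1%:R.
  have d0 : 0 <= d by rewrite divr_ge0.
  have dx : n.+1%:R * d = x by rewrite /d mulrC divfK.
  have le k : (k <= n.+1)%N -> k%:R * d <= T.
    move=> kn; rewrite (le_trans _ xT)// -dx ler_wpM2r// ler_nat//.
  have H k : (k <= n.+1)%N ->
      `|G (k%:R * d) - G 0| <= c * d * (Q (k%:R * d) - Q 0).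
    elim: k => [_|k IH kn]; first by rewrite mul0r !subrr normr0 mulr0.
    rewrite -[X in `|X|](subrKA (G (k%:R * d))) (le_trans (ler_normD _ _))//.
    rewrite -(subrKA (Q (k%:R * d)) (Q (k.+1%:R * d))) mulrDr.
    rewrite lerD//; last exact/IH/ltnW.
    apply: (le_trans (GQ _ _ _ _ _)); rewrite ?mulr_ge0 ?le//.
      by rewrite ler_wpM2r// ler_nat.
    by rewrite -natr1 mulrDl mul1r [X in X - _]addrC addrK.
  have := H n.+1 (leqnn _); rewrite dx => /(ler_wMn2r n.+1) /le_trans; apply.
  by rewrite -mulr_natl mulrA (mulrCA _ c d) dx.
(* By the Archimedean property, a positive number cannot have all its multiples bounded by [K]. *)
have [/eqP|] := eqVneq `|G x - G 0| 0.
  by rewrite normr_eq0 subr_eq0 => /eqP.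
rewrite -normr_gt0 normr_id => p.
have := step (Num.bound (K / `|G x - G 0|)).
have K0 : 0 <= K by apply: le_trans (step 0%N); rewrite mulr1n ltW.
have := archi_boundP (divr_ge0 K0 (ltW p)).
rewrite ltr_pdivrMr// mulr_natl => h1 h2.
by have := le_lt_trans h2 h1; rewrite mulrSr gtrDl ltNge ltW.
Qed.

End RealPrimitives.

(** * Integration by parts for primitives of integrable functions *)

Section ByParts.
Variable R : realType.
Local Notation mu := (@lebesgue_measure R).
Implicit Types (f g v E F : R -> R) (a b c T x y : R).

Lemma Rintegral_oo_cst x y c : x <= y -> \int[mu]_(t in `]x, y[) c = c * (y - x).
Proof.
move=> xy; rewrite Rintegral_cst//= lebesgue_measure_itv/= lte_fin.
case: ifPn => //; rewrite -leNgt => yx.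
by rewrite (@le_anti _ _ x y) ?xy// subrr.
Qed.

Lemma integrable_oo_cst x y c : mu.-integrable `]x, y[ (EFin \o (fun=> c)).
Proof. by apply: continuous_integrable_oo => z; exact: cvg_cst. Qed.

Lemma integrable_fctD (D : set R) f g : measurable D ->
  mu.-integrable D (EFin \o f) -> mu.-integrable D (EFin \o g) ->
  mu.-integrable D (EFin \o (fun t => f t + g t)).
Proof.
move=> mD i1 i2; rewrite (_ : _ \o _ = (EFin \o f) \+ (EFin \o g))%E//.
exact: integrableD.
Qed.

Lemma integrable_fctB (D : set R) f g : measurable D ->
  mu.-integrable D (EFin \o f) -> mu.-integrable D (EFin \o g) ->
  mu.-integrable D (EFin \o (fun t => f t - g t)).
Proof.
move=> mD i1 i2; rewrite (_ : _ \o _ = (EFin \o f) \- (EFin \o g))%E//.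
exact: integrableB.
Qed.

Lemma integrable_fctZ (D : set R) c f : measurable D ->
  mu.-integrable D (EFin \o f) ->
  mu.-integrable D (EFin \o (fun t => c * f t)).
Proof.
move=> mD i1; rewrite (_ : _ \o _ = (fun t => c%:E * (EFin \o f) t)%E)//.
exact: integrableZl.
Qed.

(** The product rule in integral form: [E] is continuously differentiable, whereas [F] is only a
    primitive of the integrable [v] and may fail to be differentiable at given points. *)
Lemma prim_by_parts T E dE v F : 0 <= T ->
  (forall x, is_derive x 1 E (dE x)) -> continuous dE ->
  mu.-integrable `]0, T[ (EFin \o v) ->
  (forall x, 0 <= x <= T -> F x = F 0 + prim v x) ->
  forall x, 0 <= x <= T ->
    E x * F x = E 0 * F 0 + prim (fun t => dE t * F t + E t * v t) x.
Proof.
move=> T0 dEE cdE iv FE x0 x0T.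
have cE : continuous E.
  by move=> z; apply/differentiable_continuous/derivable1_diffP; case: (dEE z).
have cF : {within `[0, T], continuous F}.
  have : {within `[0, T], continuous (fun x => F 0 + prim v x)}.
    move=> z; apply: cvgD; [exact: cvg_cst|exact: prim_continuous].
  by apply: subspace_eq_continuous => z; rewrite inE/= in_itv/= => /FE.
have iEv : mu.-integrable `]0, T[ (EFin \o (fun t => E t * v t)).
  by apply: integrableM_continuous => //; exact: continuous_subspaceT.
have idEF : mu.-integrable `]0, T[ (EFin \o (fun t => dE t * F t)).
  apply: integrableM_continuous; first exact: continuous_subspaceT.
  exact: continuous_integrable_oo.
pose h t := dE t * F t + E t * v t.
have ih : mu.-integrable `]0, T[ (EFin \o h) by exact: integrable_fctD.
have iav : mu.-integrable `]0, T[ (EFin \o (fun t => `|v t|)).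
  exact: integrable_norm.
have [M M0 dEM] := within_continuous_bounded T0 (continuous_subspaceT cdE).
(* The difference of the two sides has quadratically small increments, so
   that neither Fubini nor almost everywhere derivatives are needed. *)
suff D x y : 0 <= x -> x <= y -> y <= T ->
    `|(E y * F y - prim h y) - (E x * F x - prim h x)| <=
      (2 * M) * (y - x) * (prim (fun t => `|v t|) y - prim (fun t => `|v t|) x).
  have := eq_of_quadratic_increment D x0T.
  by rewrite prim0 subr0 => /eqP; rewrite subr_eq => /eqP.
move=> {x0 x0T} x0 xy yT.
have FB s t : 0 <= s -> s <= t -> t <= T ->
    F t - F s = \int[mu]_(r in `]s, t[) v r.
  move=> s0 st tT; rewrite -(primB s0 st tT iv) (FE s) ?(FE t); first by ring.
    by rewrite (le_trans s0 st).
  by rewrite s0 (le_trans st).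
have sub (g : R -> R) : mu.-integrable `]0, T[ (EFin \o g) ->
    mu.-integrable `]x, y[ (EFin \o g).
  exact: integrable_oo_sub.
(* The increment over [x, y] is the integral of [k]. Each summand of [k] pairs an increment of one
   factor with the density of the other, and contributes at most M (y - x) q; hence the constant 2
   M. *)
pose k t := dE t * (F y - F t) + (E x - E t) * v t.
have ik : mu.-integrable `]x, y[ (EFin \o k).
  apply: integrable_fctD => //.
    rewrite (_ : _ \o _ = EFin \o (fun t => F y * dE t - dE t * F t)); last first.
      by apply/funext => t /=; congr EFin; ring.
    apply: integrable_fctB => //; last exact: sub.
    apply/sub/continuous_integrable_oo/continuous_subspaceT => z.
    by apply: cvgM; [exact: cvg_cst|exact: cdE].
  rewrite (_ : _ \o _ = EFin \o (fun t => E x * v t - E t * v t)); last first.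
    by apply/funext => t /=; congr EFin; ring.
  apply: integrable_fctB => //; last exact: sub.
  exact/sub/integrable_fctZ.
have -> : (E y * F y - prim h y) - (E x * F x - prim h x) =
    \int[mu]_(t in `]x, y[) k t.
  have -> : \int[mu]_(t in `]x, y[) k t =
      \int[mu]_(t in `]x, y[) (F y * dE t + E x * v t - h t).
    by apply: eq_Rintegral => t _; rewrite /k /h; ring.
  have i1 : mu.-integrable `]x, y[ (EFin \o (fun t => F y * dE t)).
    by apply: integrable_fctZ => //; exact/sub/continuous_integrable_oo/continuous_subspaceT.
  have i2 : mu.-integrable `]x, y[ (EFin \o (fun t => E x * v t)).
    by apply: integrable_fctZ => //; exact: sub.
  rewrite RintegralB//; [|exact: integrable_fctD|exact: sub].
  rewrite RintegralD// RintegralZl//; last first.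
    exact/sub/continuous_integrable_oo/continuous_subspaceT.
  rewrite RintegralZl//; last exact: sub.
  rewrite -(FB x y)// -(primB x0 xy yT ih).
  have -> : \int[mu]_(t in `]x, y[) dE t = E y - E x.
    have [->|nxy] := eqVneq x y; first by rewrite set_itvoo0 Rintegral_set0 subrr.
    have {}nxy : x < y by rewrite lt_neqAle nxy.
    have cdExy : {within `[x, y], continuous dE} by exact: continuous_subspaceT.
    rewrite /Rintegral -(@integral_itv_bndoo _ _ _ _ true false); last first.
      by apply/measurable_EFinP; exact: continuous_measurable_oo.
    rewrite (@continuous_FTC2 _ dE E)//.
      split=> [z _|//|]; first by case: (dEE z).
        by apply: cvg_at_right_filter; exact: cE.
      by apply: cvg_at_left_filter; exact: cE.
    by move=> z _; rewrite derive1E; case: (dEE z).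
  ring.
have Q s t : 0 <= s -> s <= t -> t <= T ->
    0 <= prim (fun r => `|v r|) t - prim (fun r => `|v r|) s.
  by move=> s0 st tT; rewrite (primB s0 st tT iav); exact: Rintegral_ge0.
set q := prim _ y - prim _ x.
apply: (le_trans (le_normr_Rintegral _ ik)) => //.
apply: (@le_trans _ _ (\int[mu]_(t in `]x, y[) (M * q + (M * (y - x)) * `|v t|))).
  apply: le_Rintegral => //.
  - exact: integrable_norm.
  - apply: integrable_fctD => //; first exact: integrable_oo_cst.
    by apply: integrable_fctZ => //; exact: sub.
  move=> t /=; rewrite in_itv/= => /andP[xt ty].
  have t0 : 0 <= t by rewrite (le_trans x0)// ltW.
  have tT : t <= T by rewrite (le_trans (ltW ty)).
  rewrite (le_trans (ler_normD _ _))// !normrM lerD//.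
    rewrite ler_pM// ?dEM ?t0//.
    rewrite (FB t y) ?(ltW ty)// (le_trans (le_normr_Rintegral _ _))//.
      by apply: (integrable_oo_sub _ _ (sub _ iv)) => //; exact: ltW.
    rewrite -(primB t0 (ltW ty) yT iav) /q lerB//.
    by rewrite -subr_ge0 Q// ltW.
  rewrite ler_wpM2r// distrC.
  have [z zxt ->] : exists2 z, z \in `]x, t[%R & E t - E x = dE z * (t - x).
    by apply: MVT => //; exact: continuous_subspaceT.
  move: zxt; rewrite in_itv/= => /andP[xz zt].
  rewrite normrM (ger0_norm (_ : 0 <= t - x)) ?subr_ge0 ?(ltW xt)//.
  rewrite ler_pM ?subr_ge0 ?(ltW xt) ?lerB ?(ltW ty)// dEM// (le_trans x0 (ltW xz))/=.
  by rewrite (le_trans (ltW zt)).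
rewrite RintegralD//; [|exact: integrable_oo_cst|]; last first.
  by apply: integrable_fctZ => //; exact: sub.
rewrite Rintegral_oo_cst// RintegralZl//; last exact: sub.
rewrite -(primB x0 xy yT iav) -/q.
by rewrite le_eqVlt; apply/orP; left; apply/eqP; ring.
Qed.

End ByParts.

(** * Functions determined by their primitives *)

Section VanishingPrimitives.
Variable R : realType.
Local Notation mu := (@lebesgue_measure R).
Implicit Types (f g h w phi : R -> R) (a b c T x y : R).

Lemma prim_bndc T g x : 0 <= x -> x <= T ->
  mu.-integrable `]0, T[ (EFin \o g) ->
  prim g x = \int[mu]_(t in `]0, x]) g t.
Proof.
move=> x0 xT ig; rewrite /prim Rintegral_itv_bndo_bndc//.
exact: integrable_oo_sub ig.
Qed.

Lemma near_oo a b x : a < x -> x < b -> \forall y \near x, a < y < b.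
Proof.
move=> ax xb; have : x \in `]a, b[ by rewrite in_itv/= ax.
move=> /near_in_itvoo; apply: filterS => y; by rewrite in_itv.
Qed.

Lemma is_derive_prim T h x : {within `[0, T], continuous h} -> 0 < x < T ->
  is_derive x 1 (prim h) (h x).
Proof.
move=> ch /andP[x0 xT].
have ih := continuous_integrable_oo ch.
have chx : {for x, continuous h}.
  have [+ _ _] := (continuous_within_itvP _ (lt_trans x0 xT)).1 ch.
  by apply; rewrite in_itv/= x0.
have i0 : mu.-integrable `]0, T] (EFin \o h).
  apply: integrableS (integrable_oo_cc ih) => //.
  by apply: subset_itv; rewrite bnd_simp.
have ax : (BRight 0 < BRight x)%O by rewrite bnd_simp.
have [dF F'] := @continuous_FTC1 R h (BRight 0) x T xT i0 ax chx.
have : is_derive x 1 (fun y => \int[mu]_(t in `]0, y]) h t) (h x).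
  by split => //; rewrite -derive1E.
apply: near_eq_is_derive.
near=> y; rewrite (@prim_bndc T)//.
  by apply/ltW; near: y; apply: filterS (near_oo x0 xT) => y /andP[].
by apply/ltW; near: y; apply: filterS (near_oo x0 xT) => y /andP[].
Unshelve. all: by end_near. Qed.

Lemma prim_eq0_continuous T h : {within `[0, T], continuous h} ->
  (forall x, 0 < x < T -> prim h x = 0) -> forall x, 0 < x < T -> h x = 0.
Proof.
move=> ch h0 x /[dup] xT /andP[x0 xT'].
have dF := is_derive_prim ch xT.
have : is_derive x 1 (cst 0 : R -> R) (h x).
  apply: near_eq_is_derive dF; apply: filterS (near_oo x0 xT') => y.
  exact: h0.
by case=> _ <-; rewrite derive_cst.
Qed.

(** By Lebesgue's differentiation theorem the primitive of [g] has derivative [g] almost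
    everywhere. *)
Lemma prim_eq0_ae T g : mu.-integrable `]0, T[ (EFin \o g) ->
  (forall x, 0 < x < T -> prim g x = 0) ->
  {ae mu, forall x, 0 < x < T -> g x = 0}.
Proof.
move=> ig g0.
(* Extension by 0 makes [g] integrable on the whole line, where the differentiation theorem is
   applied. *)
pose G := g \_ `]0, T[.
have iG : mu.-integrable setT (EFin \o G).
  by rewrite -restrict_EFin; apply/integrable_restrict => //; rewrite setTI.
have iGy y : mu.-integrable `]0, y] (EFin \o G) by exact: integrableS iG.
have lG : locally_integrable setT G by exact: integrable_locally_restrict.
have := @FTC1 R G (BRight 0) iGy lG.
have F := @ae_filter_ringOfSetsType _ _ _ mu.
apply: filterS => x /= dF /andP[x0 xT].
have {dF}[dF] : _ /\ _ := dF x0.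
have Gg y : 0 < y < T -> G y = g y by move=> yT; rewrite /G patchE mem_set.
rewrite Gg ?x0// => <-.
rewrite derive1E.
have -> : 'D_1 (fun y => \int[mu]_(t in `]0, y]) G t) x = 'D_1 (cst 0 : R -> R) x.
  apply: near_eq_derive; apply: filterS (near_oo x0 xT) => y yy.
  transitivity (prim g y); last exact: g0.
  move: yy => /andP[y0 yT]; rewrite (prim_bndc (ltW y0) (ltW yT))//.
  apply: eq_Rintegral => z; rewrite inE/= in_itv/= => /andP[z0 zy].
  by rewrite Gg// z0 (le_lt_trans zy).
by rewrite derive_cst.
Qed.

Lemma eq_itvcc_of_itvoo T f g : 0 < T ->
  {within `[0, T], continuous f} -> {within `[0, T], continuous g} ->
  (forall x, 0 < x < T -> f x = g x) -> forall x, 0 <= x <= T -> f x = g x.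
Proof.
move=> T0 /(continuous_within_itvP _ T0)[_ f0 fT].
move=> /(continuous_within_itvP _ T0)[_ g0 gT] fg x /andP[].
rewrite le_eqVlt => /predU1P[<- _|x0].
  apply: (@cvg_unique _ _ (f z @[z --> 0^'+])) => //.
  apply: cvg_trans g0; apply: near_eq_cvg; near=> z; apply/esym/fg.
  by apply/andP; split; near: z; [exact: nbhs_right_gt|exact: nbhs_right_lt].
rewrite le_eqVlt => /predU1P[->|xT]; last by apply: fg; rewrite x0.
apply: (@cvg_unique _ _ (f z @[z --> T^'-])) => //.
apply: cvg_trans gT; apply: near_eq_cvg; near=> z; apply/esym/fg.
by apply/andP; split; near: z; [exact: nbhs_left_gt|exact: nbhs_left_lt].
Unshelve. all: by end_near. Qed.

(** The difference has zero primitive, so it vanishes in the open interval, and one-sided limits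
    carry this to the end points. This is what makes the boundary values of an L2 class well
    defined. *)
Lemma eq_itvcc_of_ae T f g : 0 < T ->
  {within `[0, T], continuous f} -> {within `[0, T], continuous g} ->
  {ae mu, forall x, 0 < x < T -> f x = g x} ->
  forall x, 0 <= x <= T -> f x = g x.
Proof.
move=> T0 cf cg fg; apply: eq_itvcc_of_itvoo => // x xT.
have cd : {within `[0, T], continuous (f \- g)}.
  by move=> z; apply: cvgB; [exact: cf|exact: cg].
apply/eqP; rewrite -subr_eq0; apply/eqP.
apply: (prim_eq0_continuous cd _ xT) => {xT} y /andP[y0 yT].
have id : mu.-integrable `]0, y[ (EFin \o (f \- g)).
  by apply: (integrable_oo_sub _ _ (continuous_integrable_oo cd)) => //; exact: ltW.
rewrite /prim /Rintegral (ae_eq_integral (cst 0%E)) ?integral0//.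
  exact: measurable_int id.
have F := @ae_filter_ringOfSetsType _ _ _ mu.
apply: filterS fg => z zfg /=; rewrite in_itv/= => /andP[z0 zy].
by rewrite zfg ?subrr// z0 (lt_trans zy).
Qed.

End VanishingPrimitives.

(** * The lemma of du Bois-Reymond *)

Section DuBoisReymond.
Variable R : realType.
Local Notation mu := (@lebesgue_measure R).
Implicit Types (f g h w phi : R -> R) (a b c T x y : R).

(** The primitive is nondecreasing and vanishes at both ends, hence everywhere in between. *)
Lemma prim_ge0_eq0 T h : {within `[0, T], continuous h} ->
  (forall x, 0 < x < T -> 0 <= h x) -> prim h T = 0 ->
  forall x, 0 < x < T -> h x = 0.
Proof.
move=> ch h0 hT; apply: prim_eq0_continuous => // x /andP[x0 xT].
have ih := continuous_integrable_oo ch.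
have p0 : 0 <= prim h x.
  apply: Rintegral_ge0 => t /=; rewrite in_itv/= => /andP[t0 tx].
  by rewrite h0// t0 (lt_trans tx).
have p1 : 0 <= prim h T - prim h x.
  rewrite (primB (ltW x0) (ltW xT) _ ih)//.
  apply: Rintegral_ge0 => t /=; rewrite in_itv/= => /andP[xt tT].
  by rewrite h0// tT (lt_trans x0).
by move: p1; rewrite hT sub0r oppr_ge0 => p1; apply/le_anti; rewrite p0 p1.
Qed.

Lemma prim_eq_fct f g x : (forall t, 0 < t < x -> f t = g t) ->
  prim f x = prim g x.
Proof. by move=> fg; apply: eq_Rintegral => t; rewrite inE/= in_itv/= => /fg. Qed.

Lemma Rintegral_oo_eq0 g x y : (forall t, x < t < y -> g t = 0) ->
  \int[mu]_(t in `]x, y[) g t = 0.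
Proof.
move=> g0; rewrite (@eq_Rintegral _ _ _ mu _ (cst 0)) ?Rintegral_cst ?mul0r//.
by move=> t; rewrite inE/= in_itv/= => /g0.
Qed.

Lemma du_bois_reymond T w : 0 < T -> {within `[0, T], continuous w} ->
  (forall phi dphi : R -> R, (forall x, is_derive x 1 phi (dphi x)) ->
    continuous dphi ->
    (exists a b, [/\ 0 < a, b < T & forall x, ~~ (a <= x <= b) -> phi x = 0]) ->
    prim (fun t => w t * dphi t) T = 0) ->
  forall x, 0 <= x <= T -> w x = w 0.
Proof.
move=> T0 cw wphi.
suff wxy x y : 0 < x < T -> 0 < y < T -> w x = w y.
  have h2 : 0 < T / 2 < T by apply/andP; split; lra.
  have e : forall x, 0 <= x <= T -> w x = w (T / 2).
    apply: (@eq_itvcc_of_itvoo _ _ _ (cst (w (T / 2)))) => // [|x xT].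
      by move=> z; exact: cvg_cst.
    exact: wxy.
  by move=> x xT; rewrite !e// lexx ltW.
move=> /andP[x0 xT] /andP[y0 yT].
(* The interval ]a, b[ contains both [x] and [y], while [a, b] stays inside ]0, T[ as a test
   function requires. *)
pose a := Num.min x y / 2; pose b := (Num.max x y + T) / 2.
have m0 : 0 < Num.min x y by rewrite lt_min x0.
have MT : Num.max x y < T by rewrite gt_max xT.
have a0 : 0 < a by rewrite divr_gt0.
have bT : b < T by rewrite /b; lra.
have inab z : Num.min x y <= z -> z <= Num.max x y -> a < z < b.
  by move=> z1 z2; apply/andP; split; rewrite /a/b; lra.
have ab : a < b.
  have /andP[ax xb] : a < x < b by rewrite inab ?ge_min ?le_max ?lexx.
  exact: lt_trans xb.
(* The test function is the primitive of chi (w - m), where chi > 0 on ]a, b[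
   vanishes outside and m is the chi-weighted mean of w: it yields
   that the integral of chi (w - m)^2 is 0. *)
pose q (t : R) : R := (t - a) * (b - t).
(* [chi] is twice the positive part of [q]: continuous on the whole line and positive exactly on ]a,
   b[. *)
pose chi (t : R) : R := `|q t| + q t.
have cq : continuous q.
  move=> t; apply: cvgM; first by apply: cvgB; [exact: cvg_id|exact: cvg_cst].
  by apply: cvgB; [exact: cvg_cst|exact: cvg_id].
have cchi : continuous chi.
  by move=> t; apply: cvgD; [apply: cvg_norm|]; exact: cq.
have chi0 t : 0 <= chi t by rewrite /chi -lerBlDr sub0r -normrN ler_norm.
have chi_out t : ~~ (a < t < b) -> chi t = 0.
  move=> tab; rewrite /chi ler0_norm ?addNr// /q.
  move: tab; rewrite negb_and -!leNgt => /orP[ta|bt].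
    by rewrite mulr_le0_ge0 ?subr_le0 ?subr_ge0// (le_trans ta)// ltW.
  by rewrite mulr_ge0_le0 ?subr_le0 ?subr_ge0// (le_trans _ bt)// ltW.
have chi_in t : a < t < b -> 0 < chi t.
  move=> /andP[a1 b1]; have : 0 < q t by rewrite mulr_gt0 ?subr_gt0.
  by move=> q0; rewrite /chi addr_gt0// normr_gt0 gt_eqF.
have cchiT : {within `[0, T], continuous chi} by exact: continuous_subspaceT.
pose m := prim (fun t => chi t * w t) T / prim chi T.
have chiT : prim chi T != 0.
  apply/eqP => h; have := prim_ge0_eq0 cchiT (fun t _ => chi0 t) h.
  move=> /(_ x); rewrite x0 xT => /(_ isT) => e; have := @chi_in x.
  by rewrite e ltxx inab ?ge_min ?le_max ?lexx ?orbT// => /(_ isT).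
pose dphi (t : R) : R := chi t * (w t - m).
have dphi_out t : ~~ (a < t < b) -> dphi t = 0.
  by move=> /chi_out; rewrite /dphi => ->; rewrite mul0r.
have [cwoo _ _] := (continuous_within_itvP _ T0).1 cw.
(* Nothing is known about [w] outside [0, T], but near such points, and near 0 and T, the factor
   [chi] is 0. *)
have cdphi : continuous dphi.
  move=> t; have [tT|] := boolP (0 < t < T).
    apply: cvgM; first exact: cchi.
    by apply: cvgB; [apply: cwoo; rewrite in_itv|exact: cvg_cst].
  rewrite negb_and -!leNgt => tT.
  have out s : ~~ (a < s < b) -> dphi s = 0 by exact: dphi_out.
  rewrite /continuous_at out; last first.
    rewrite negb_and -!leNgt; case/orP: tT => tT.
      by rewrite (le_trans tT (ltW a0)).
    by rewrite (le_trans (ltW bT) tT) orbT.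
  apply: cvg_near_cst; case/orP: tT => tT; near=> s.
    rewrite out// negb_and -!leNgt; apply/orP; left; apply/ltW; near: s.
    by apply: lt_nbhsl; rewrite (le_lt_trans tT).
  rewrite out// negb_and -!leNgt; apply/orP; right; apply/ltW; near: s.
  by apply: lt_nbhsr; rewrite (lt_le_trans bT).
have ichiw : mu.-integrable `]0, T[ (EFin \o (fun t => chi t * w t)).
  by apply: integrableM_continuous => //; exact: continuous_integrable_oo.
have ichi : mu.-integrable `]0, T[ (EFin \o chi) by exact: continuous_integrable_oo.
have idphi x' : mu.-integrable `]0, x'[ (EFin \o dphi).
  by apply: continuous_integrable_oo; exact: continuous_subspaceT.
have dphiT : prim dphi T = 0.
  rewrite (@prim_eq_fct _ (fun t => chi t * w t - m * chi t)); last first.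
    by move=> t _; rewrite /dphi; ring.
  rewrite /prim RintegralB//; last exact: integrable_fctZ.
  by rewrite RintegralZl// /m divfK// subrr.
have phi_l t : t <= a -> prim dphi t = 0.
  move=> ta; apply: Rintegral_oo_eq0 => s /andP[_ st]; rewrite dphi_out//.
  by rewrite negb_and -leNgt (le_trans (ltW st)).
have phi_r t : b <= t -> prim dphi t = prim dphi b.
  move=> bt; apply/eqP; rewrite -subr_eq0.
  rewrite (primB _ bt (lexx t))//; last by rewrite ltW// (lt_trans a0).
  apply/eqP/Rintegral_oo_eq0 => s /andP[bs _]; rewrite dphi_out//.
  by rewrite negb_and -!leNgt (ltW bs) orbT.
have dphiE (t : R) : is_derive t 1 (prim dphi) (dphi t).
  have [t0|t0] := ltP 0 t.
    apply: (@is_derive_prim _ (t + 1)); first exact: continuous_subspaceT.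
    by rewrite t0 ltrDl ltr01.
  (* For t <= 0 the primitive is locally constant: it vanishes up to a > 0. *)
  rewrite dphi_out; last by rewrite negb_and -!leNgt (le_trans t0 (ltW a0)).
  apply: (@near_eq_is_derive _ _ _ (cst 0 : R -> R)).
  near=> s; rewrite phi_l// ltW//; near: s.
  by apply: lt_nbhsl; rewrite (le_lt_trans t0).
have : prim (fun t => w t * dphi t) T = 0.
  apply: wphi dphiE cdphi _; exists a, b; split => // t; rewrite negb_and -!ltNge.
  by move=> /orP[/ltW/phi_l//|/ltW/phi_r ->]; rewrite -(phi_r T) ?(ltW bT).
have cwm : {within `[0, T], continuous (fun t => w t - m)}.
  by move=> z; apply: cvgB; [exact: cw|exact: cvg_cst].
pose h (t : R) : R := chi t * (w t - m) ^+ 2.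
have ch : {within `[0, T], continuous h}.
  move=> z; apply: cvgM; first exact: cchiT.
  by apply: cvgM; exact: cwm.
move=> wdphi.
have hT : prim h T = 0.
  rewrite (@prim_eq_fct _ (fun t => w t * dphi t - m * dphi t)); last first.
    by move=> t _; rewrite /h /dphi; ring.
  rewrite /prim RintegralB//; last 2 first.
  - apply: integrableM_continuous => //.
  - exact: integrable_fctZ.
  by rewrite RintegralZl// -/(prim _ _) -/(prim _ _) wdphi dphiT mulr0 subrr.
have wm z : Num.min x y <= z <= Num.max x y -> w z = m.
  move=> /andP[z1 z2].
  have zab := inab _ z1 z2.
  have : h z = 0.
    apply: (@prim_ge0_eq0 T) => //.
      by move=> t _; rewrite mulr_ge0// sqr_ge0.
    by rewrite (lt_le_trans m0 z1) (le_lt_trans z2).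
  move=> /eqP; rewrite mulf_eq0 (gt_eqF (chi_in _ zab)) sqrf_eq0 subr_eq0.
  by move=> /eqP.
by rewrite !wm// ?ge_min ?le_max ?lexx ?orbT.
Unshelve. all: by end_near.
Qed.

End DuBoisReymond.

(** * Complex-valued primitives *)

Section ComplexPrimitives.
Variable R : realType.
Local Notation mu := (@lebesgue_measure R).
Local Notation Re := (@complex.Re R).
Local Notation Im := (@complex.Im R).
Implicit Types (f g h E F v : R -> R[i]) (T x y : R) (a b z : R[i]).

Lemma ReD a b : Re (a + b) = Re a + Re b. Proof. by case: a b => [? ?] []. Qed.
Lemma ImD a b : Im (a + b) = Im a + Im b. Proof. by case: a b => [? ?] []. Qed.
Lemma ReN a : Re (- a) = - Re a. Proof. by case: a. Qed.
Lemma ImN a : Im (- a) = - Im a. Proof. by case: a. Qed.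
Lemma ReM a b : Re (a * b) = Re a * Re b - Im a * Im b.
Proof. by case: a b => [? ?] []. Qed.
Lemma ImM a b : Im (a * b) = Re a * Im b + Im a * Re b.
Proof. by case: a b => [? ?] []. Qed.

Definition ReImE := (ReD, ImD, ReN, ImN, ReM, ImM).

Lemma eqC a b : Re a = Re b -> Im a = Im b -> a = b.
Proof. by case: a b => [? ?] [? ?] /= -> ->. Qed.

(** Componentwise, so that the results on real functions apply directly; [within_continuous_ccont]
    relates this to the topology of the complex numbers. *)
Definition ccont T f : Prop :=
  {within `[0, T], continuous (fun t => Re (f t))} /\
  {within `[0, T], continuous (fun t => Im (f t))}.

Definition cintegrable T f : Prop :=
  mu.-integrable `]0, T[ (EFin \o (fun t => Re (f t))) /\
  mu.-integrable `]0, T[ (EFin \o (fun t => Im (f t))).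

Definition cprim f x : R[i] :=
  prim (fun t => Re (f t)) x +i* prim (fun t => Im (f t)) x.

Lemma eq_ccont T f g : (forall t, 0 <= t <= T -> f t = g t) ->
  ccont T f -> ccont T g.
Proof.
move=> fg [fr fi]; split; [apply: subspace_eq_continuous fr|
  apply: subspace_eq_continuous fi];
  by move=> t; rewrite inE/= in_itv/= /from_subspace => /fg ->.
Qed.

Lemma ccont_cst T a : ccont T (fun=> a).
Proof. by split=> t; exact: cvg_cst. Qed.

Lemma ccontD T f g : ccont T f -> ccont T g -> ccont T (fun t => f t + g t).
Proof.
move=> [fr fi] [gr gi]; split.
  rewrite (_ : (fun t => _) = fun t => Re (f t) + Re (g t)).
    by move=> t; apply: cvgD; [exact: fr|exact: gr].
  by apply/funext => t; rewrite ReD.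
rewrite (_ : (fun t => _) = fun t => Im (f t) + Im (g t)).
  by move=> t; apply: cvgD; [exact: fi|exact: gi].
by apply/funext => t; rewrite ImD.
Qed.

Lemma ccontM T f g : ccont T f -> ccont T g -> ccont T (fun t => f t * g t).
Proof.
move=> [fr fi] [gr gi]; split.
  rewrite (_ : (fun t => _) = fun t => Re (f t) * Re (g t) - Im (f t) * Im (g t)).
    move=> t; apply: cvgB; apply: cvgM;
      [exact: fr|exact: gr|exact: fi|exact: gi].
  by apply/funext => t; rewrite ReM.
rewrite (_ : (fun t => _) = fun t => Re (f t) * Im (g t) + Im (f t) * Re (g t)).
  move=> t; apply: cvgD; apply: cvgM;
    [exact: fr|exact: gi|exact: fi|exact: gr].
by apply/funext => t; rewrite ImM.
Qed.

Lemma ccont_cintegrable T f : ccont T f -> cintegrable T f.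
Proof. by move=> [fr fi]; split; exact: continuous_integrable_oo. Qed.

Lemma eq_cintegrable T f g : (forall t, f t = g t) ->
  cintegrable T f -> cintegrable T g.
Proof. by move=> /funext ->. Qed.

Lemma cintegrableD T f g : cintegrable T f -> cintegrable T g ->
  cintegrable T (fun t => f t + g t).
Proof.
move=> [fr fi] [gr gi]; split.
  rewrite (_ : _ \o _ = EFin \o fun t => Re (f t) + Re (g t)).
    exact: integrable_fctD.
  by apply/funext => t /=; rewrite ReD.
rewrite (_ : _ \o _ = EFin \o fun t => Im (f t) + Im (g t)).
  exact: integrable_fctD.
by apply/funext => t /=; rewrite ImD.
Qed.

Lemma cintegrableM T f g : ccont T f -> cintegrable T g ->
  cintegrable T (fun t => f t * g t).
Proof.
move=> [fr fi] [gr gi]; split.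
  rewrite (_ : _ \o _ =
      EFin \o fun t => Re (f t) * Re (g t) - Im (f t) * Im (g t)).
    by apply: integrable_fctB => //; exact: integrableM_continuous.
  by apply/funext => t /=; rewrite ReM.
rewrite (_ : _ \o _ =
    EFin \o fun t => Re (f t) * Im (g t) + Im (f t) * Re (g t)).
  by apply: integrable_fctD => //; exact: integrableM_continuous.
by apply/funext => t /=; rewrite ImM.
Qed.

Lemma cintegrableZ T a f : cintegrable T f -> cintegrable T (fun t => a * f t).
Proof. by move=> ?; apply: cintegrableM => //; exact: ccont_cst. Qed.

Lemma cintegrable_le T x f : x <= T -> cintegrable T f -> cintegrable x f.
Proof. by move=> xT [fr fi]; split; [move: fr|move: fi]; exact: integrable_oo_sub. Qed.

Lemma cprim0 f : cprim f 0 = 0.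
Proof. by rewrite /cprim !prim0. Qed.

Lemma eq_cprim f g x : (forall t, 0 < t < x -> f t = g t) ->
  cprim f x = cprim g x.
Proof.
by move=> fg; congr (_ +i* _); apply: prim_eq_fct => t /fg ->.
Qed.

Lemma cprimD f g x : cintegrable x f -> cintegrable x g ->
  cprim (fun t => f t + g t) x = cprim f x + cprim g x.
Proof.
move=> [fr fi] [gr gi]; apply: eqC; rewrite ReImE /=.
  rewrite (@prim_eq_fct _ _ (fun t => Re (f t) + Re (g t))).
    by rewrite /prim RintegralD.
  by move=> t _; rewrite ReD.
rewrite (@prim_eq_fct _ _ (fun t => Im (f t) + Im (g t))).
  by rewrite /prim RintegralD.
by move=> t _; rewrite ImD.
Qed.

Lemma cprimZ a f x : cintegrable x f ->
  cprim (fun t => a * f t) x = a * cprim f x.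
Proof.
move=> [fr fi]; apply: eqC; rewrite ReImE /=.
  rewrite (@prim_eq_fct _ _ (fun t => Re a * Re (f t) - Im a * Im (f t))).
    by rewrite /prim RintegralB ?RintegralZl//; exact: integrable_fctZ.
  by move=> t _; rewrite ReM.
rewrite (@prim_eq_fct _ _ (fun t => Re a * Im (f t) + Im a * Re (f t))).
  by rewrite /prim RintegralD ?RintegralZl//; exact: integrable_fctZ.
by move=> t _; rewrite ImM.
Qed.

Lemma cprim_ccont T f : 0 <= T -> cintegrable T f -> ccont T (cprim f).
Proof. by move=> T0 [fr fi]; split; exact: prim_continuous. Qed.

Definition cC1 E dE : Prop :=
  [/\ forall x, is_derive x 1 (fun t => Re (E t)) (Re (dE x)),
      forall x, is_derive x 1 (fun t => Im (E t)) (Im (dE x)),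
      continuous (fun t => Re (dE t)) & continuous (fun t => Im (dE t))].

Lemma is_derive_continuous (e de : R -> R) :
  (forall x, is_derive x 1 e (de x)) -> continuous e.
Proof.
by move=> d z; apply/differentiable_continuous/derivable1_diffP; case: (d z).
Qed.

Lemma cC1_ccont T E dE : cC1 E dE -> ccont T E.
Proof.
by move=> [/is_derive_continuous c1 /is_derive_continuous c2 _ _]; split;
  exact: continuous_subspaceT.
Qed.

Lemma cC1_ccontD T E dE : cC1 E dE -> ccont T dE.
Proof. by move=> [_ _ c1 c2]; split; exact: continuous_subspaceT. Qed.

Lemma prim_fctD (p q : R -> R) x : mu.-integrable `]0, x[ (EFin \o p) ->
  mu.-integrable `]0, x[ (EFin \o q) ->
  prim (fun t => p t + q t) x = prim p x + prim q x.
Proof. by move=> ip iq; rewrite /prim RintegralD. Qed.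

Lemma prim_fctB (p q : R -> R) x : mu.-integrable `]0, x[ (EFin \o p) ->
  mu.-integrable `]0, x[ (EFin \o q) ->
  prim (fun t => p t - q t) x = prim p x - prim q x.
Proof. by move=> ip iq; rewrite /prim RintegralB. Qed.

Lemma cprim_by_parts T E dE v F : 0 <= T -> cC1 E dE -> cintegrable T v ->
  (forall x, 0 <= x <= T -> F x = F 0 + cprim v x) ->
  forall x, 0 <= x <= T ->
    E x * F x = E 0 * F 0 + cprim (fun t => dE t * F t + E t * v t) x.
Proof.
move=> T0 CE [vr vi] FE x xT.
have cF : ccont T F.
  apply: (@eq_ccont _ (fun x => F 0 + cprim v x)); first by move=> t /FE.
  by apply: ccontD; [exact: ccont_cst|exact: cprim_ccont].
have [CF1 CF2] := cF.
have [CE1 CE2] := cC1_ccont T CE.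
have [CD1 CD2] := cC1_ccontD T CE.
have [dr di cr ci] := CE.
have Fr t : 0 <= t <= T -> Re (F t) = Re (F 0) + prim (fun t => Re (v t)) t.
  by move=> /FE ->; rewrite ReD.
have Fi t : 0 <= t <= T -> Im (F t) = Im (F 0) + prim (fun t => Im (v t)) t.
  by move=> /FE ->; rewrite ImD.
(* Complex multiplication mixes components, so all four pairings of a component of [E] with one of
   [F] occur. *)
have rr := prim_by_parts T0 dr cr vr Fr xT.
have ri := prim_by_parts T0 dr cr vi Fi xT.
have ir := prim_by_parts T0 di ci vr Fr xT.
have ii := prim_by_parts T0 di ci vi Fi xT.
have I (p dp u k : R -> R) : {within `[0, T], continuous p} ->
    {within `[0, T], continuous dp} -> {within `[0, T], continuous k} ->
    mu.-integrable `]0, T[ (EFin \o u) ->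
    mu.-integrable `]0, x[ (EFin \o (fun t => dp t * k t + p t * u t)).
  move=> cp cdp ck iu; apply: (@integrable_oo_sub _ 0 T) => //.
    by case/andP: xT.
  apply: integrable_fctD => //; apply: integrableM_continuous => //.
  exact: continuous_integrable_oo.
apply: eqC; rewrite !ReImE /= ?rr ?ri ?ii ?ir.
  rewrite [in RHS](@prim_eq_fct _ _ (fun t =>
      (Re (dE t) * Re (F t) + Re (E t) * Re (v t)) -
      (Im (dE t) * Im (F t) + Im (E t) * Im (v t)))); last first.
    by move=> t _; rewrite !ReImE; ring.
  by rewrite prim_fctB; [ring|exact: I|exact: I].
rewrite [in RHS](@prim_eq_fct _ _ (fun t =>
    (Re (dE t) * Im (F t) + Re (E t) * Im (v t)) +
    (Im (dE t) * Re (F t) + Im (E t) * Re (v t)))); last first.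
  by move=> t _; rewrite !ReImE; ring.
by rewrite [X in _ = _ + X]prim_fctD; [ring|exact: I|exact: I].
Qed.

End ComplexPrimitives.

(** * L2 classes and their representatives *)

Section L2Elements.
Variable R : realType.
Local Notation mu := (@lebesgue_measure R).
Local Notation Re := (@complex.Re R).
Local Notation Im := (@complex.Im R).
Local Notation T := (2 * pi : R).

Lemma twopi_gt0 : 0 < T. Proof. by rewrite mulr_gt0// pi_gt0. Qed.

Lemma twopi_ge0 : 0 <= T. Proof. exact: ltW twopi_gt0. Qed.

(** L2 embeds into L1 on an interval of finite length, because |z| <= 1 + |z|^2. *)
Lemma sq_integrable_cintegrable (f : R -> R[i]) :
  sq_integrable f -> cintegrable T f.
Proof.
move=> [mr mi fi].
have i2 : mu.-integrable `]0, T[ (EFin \o (fun t => 1 + normc (f t) ^+ 2)).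
  apply: integrable_fctD => //; first exact: integrable_oo_cst.
  apply/integrableP; split; first exact: measurable_sq_normc.
  apply: le_lt_trans fi; rewrite le_eqVlt; apply/orP; left; apply/eqP.
  apply: eq_integral => t _.
  by rewrite /= ger0_norm// sqr_ge0.
have le (x y : R) : `|x| <= `|1 + (x ^+ 2 + y ^+ 2)|.
  rewrite [X in _ <= X]ger0_norm ?addr_ge0 ?sqr_ge0//.
  by have := normr_ge0 x; rewrite -[x ^+ 2]real_normK ?num_real//; nra.
split; apply: le_integrable i2 => //; try exact/measurable_EFinP.
- by move=> t _ /=; rewrite lee_fin sq_normc.
- by move=> t _ /=; rewrite lee_fin sq_normc [X in 1 + X]addrC.
Qed.

Lemma ccont_sq_integrable (f : R -> R[i]) : ccont T f -> sq_integrable f.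
Proof.
move=> [fr fi]; split; try exact: continuous_measurable_oo.
have cc : {within `[0, T], continuous (fun t => Re (f t) ^+ 2 + Im (f t) ^+ 2)}.
  by move=> t; apply: cvgD; apply: cvgM; solve [exact: fr|exact: fi].
have /integrableP[_] := continuous_integrable_oo cc.
apply: le_lt_trans; rewrite le_eqVlt; apply/orP; left; apply/eqP.
apply: eq_integral => t _.
by rewrite /= ger0_norm ?addr_ge0 ?sqr_ge0// sq_normc.
Qed.

Lemma L2_sq_integrable (u : L2 R) : sq_integrable (u : R -> R[i]).
Proof. by rewrite /L2_to_fun; case: (repr u) => f /= /asboolP. Qed.

Lemma L2_cintegrable (u : L2 R) : cintegrable T u.
Proof. exact/sq_integrable_cintegrable/L2_sq_integrable. Qed.

Local Open Scope quotient_scope.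

Lemma eq_pi_L2 (f g : L2fun R) :
  (\pi_(L2 R) f = \pi_(L2 R) g) <->
  {ae mu, forall x, 0 < x < T -> f x = g x}.
Proof.
have F := @ae_filter_ringOfSetsType _ _ _ mu.
split=> [/eqP|fg].
  rewrite -Quotient.idealrBE => /asboolP; apply: filterS => x fg xT.
  apply/eqP; rewrite -subr_eq0; apply/eqP; apply: fg.
  by rewrite /I02pi /= in_itv.
apply/eqP; rewrite -Quotient.idealrBE; apply/asboolP.
apply: filterS fg => x fg xT.
apply/eqP; rewrite subr_eq0; apply/eqP; apply: fg.
by move: xT; rewrite /I02pi /= in_itv.
Qed.

Lemma L2_eqP (u v : L2 R) :
  u = v <-> {ae mu, forall x, 0 < x < T -> u x = v x}.
Proof.
by have := eq_pi_L2 (repr u) (repr v); rewrite !reprK.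
Qed.

Lemma pi_L2_ae (f : L2fun R) :
  {ae mu, forall x, 0 < x < T -> (\pi_(L2 R) f : L2 R) x = f x}.
Proof. by apply/eq_pi_L2; rewrite reprK. Qed.

Lemma L2_of_sq_integrable (f : R -> R[i]) : sq_integrable f ->
  exists u : L2 R, {ae mu, forall x, 0 < x < T -> u x = f x}.
Proof.
move=> /asboolP sf; exists (\pi_(L2 R) (MkL2fun (sf : f \in @sqint R))).
exact: pi_L2_ae.
Qed.

(** [repr] chooses representatives and is not linear, so values of a linear combination are
    controlled only almost everywhere. *)
Lemma L2_lin_ae (a : R[i]) (u v : L2 R) :
  {ae mu, forall x, 0 < x < T -> (a *: u + v : L2 R) x = a * u x + v x}.
Proof.
have := pi_L2_ae (a *: repr u + repr v).
rewrite pi_L2D reprK; exact.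
Qed.

Lemma cprim_ae (f g : R -> R[i]) x : x <= T ->
  cintegrable T f -> cintegrable T g ->
  {ae mu, forall x, 0 < x < T -> f x = g x} -> cprim f x = cprim g x.
Proof.
move=> xT fi gi fg.
have F := @ae_filter_ringOfSetsType _ _ _ mu.
have [fr' fi'] := cintegrable_le xT fi.
have [gr' gi'] := cintegrable_le xT gi.
congr (_ +i* _); rewrite /prim /Rintegral; congr fine; apply: ae_eq_integral => //.
- exact: measurable_int fr'.
- exact: measurable_int gr'.
- apply: filterS fg => t fg /=; rewrite in_itv/= => /andP[t0 tx].
  by rewrite fg// t0 (lt_le_trans tx).
- exact: measurable_int fi'.
- exact: measurable_int gi'.
- apply: filterS fg => t fg /=; rewrite in_itv/= => /andP[t0 tx].
  by rewrite fg// t0 (lt_le_trans tx).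
Qed.

Lemma cprim_eq_ae (f g : R -> R[i]) :
  cintegrable T f -> cintegrable T g ->
  (forall x, 0 <= x <= T -> cprim f x = cprim g x) ->
  {ae mu, forall x, 0 < x < T -> f x = g x}.
Proof.
move=> [fr fi] [gr gi] fg.
have F := @ae_filter_ringOfSetsType _ _ _ mu.
have sub (p q : R -> R) : mu.-integrable `]0, T[ (EFin \o p) ->
    mu.-integrable `]0, T[ (EFin \o q) ->
    (forall x, 0 <= x <= T -> prim p x = prim q x) ->
    {ae mu, forall x, 0 < x < T -> p x = q x}.
  move=> ip iq pq.
  have h : {ae mu, forall x, 0 < x < T -> p x - q x = 0}.
    apply: (@prim_eq0_ae _ T) => [|x /andP[x0 xT]].
      exact: integrable_fctB.
    have sx := fun g => @integrable_oo_sub R 0 T 0 x g (lexx _) (ltW xT).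
    rewrite prim_fctB; [|exact: sx|exact: sx].
    by rewrite pq ?subrr// !ltW.
  apply: filterS h => x h /h /eqP.
  by rewrite subr_eq0 => /eqP.
have r : {ae mu, forall x, 0 < x < T -> Re (f x) = Re (g x)}.
  by apply: sub => // x /fg [].
have i : {ae mu, forall x, 0 < x < T -> Im (f x) = Im (g x)}.
  by apply: sub => // x /fg [].
by apply: filterS2 r i => x h1 h2 xT; apply: eqC; [exact: h1|exact: h2].
Qed.

End L2Elements.

(** * Weak derivatives and continuous representatives *)

Section WeakDerivatives.
Variable R : realType.
Local Notation mu := (@lebesgue_measure R).
Local Notation Re := (@complex.Re R).
Local Notation Im := (@complex.Im R).
Local Notation C := (R[i]^o).
Local Notation T := (2 * pi : R).
Implicit Types (x : R).

Lemma normr_Re_le (z : R[i]) : `|Re z| <= normc z.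
Proof.
by case: z => a b /=; rewrite -sqrtr_sqr ler_wsqrtr// lerDl sqr_ge0.
Qed.

Lemma normr_Im_le (z : R[i]) : `|Im z| <= normc z.
Proof.
by case: z => a b /=; rewrite -sqrtr_sqr ler_wsqrtr// lerDr sqr_ge0.
Qed.

Lemma normc_real (a : R) : normc a%:C = `|a|.
Proof. by rewrite /= expr0n addr0 sqrtr_sqr. Qed.

Lemma normc_le_ReIm (z : R[i]) : normc z <= `|Re z| + `|Im z|.
Proof.
case: z => a b /=; rewrite -[X in _ <= X]ger0_norm ?addr_ge0// -sqrtr_sqr.
apply: ler_wsqrtr; rewrite sqrrD !real_normK ?num_real//.
by rewrite -addrA lerD2l lerDr mulrn_wge0// mulr_ge0.
Qed.

Lemma cvg_complexP (X : Type) (F : set_system X) (FF : Filter F)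
    (f : X -> C) (l : C) :
  f @ F --> l <->
  (fun t => Re (f t)) @ F --> Re l /\ (fun t => Im (f t)) @ F --> Im l.
Proof.
split=> [/cvgrPdist_lt fl|[/cvgrPdist_lt fr /cvgrPdist_lt fi]].
  have H (e : R) : 0 < e -> \forall t \near F, normc (l - f t) < e.
    move=> e0; have e0' : 0 < e%:C by rewrite ltcR.
    by apply: filterS (fl _ e0') => t; rewrite -ltcR.
  split; apply/cvgrPdist_lt => e /H; apply: filterS => t; apply: le_lt_trans.
    by rewrite -ReN -ReD; exact: normr_Re_le.
  by rewrite -ImN -ImD; exact: normr_Im_le.
(* Radii are positive elements of R[i]; for its order this means imaginary part 0 and positive real
   part. *)
apply/cvgrPdist_lt => -[e e']; rewrite ltcE/= => /andP[/eqP -> e0].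
have e2 : 0 < e / 2 by rewrite divr_gt0.
apply: filterS2 (fr _ e2) (fi _ e2) => t tr ti.
rewrite -[X in _ < X]/(e%:C) -[X in X < _]/((normc (l - f t))%:C) ltcR.
apply: le_lt_trans (normc_le_ReIm _) _.
by rewrite [e]splitr; apply: ltrD; rewrite ?ReD ?ReN ?ImD ?ImN.
Qed.

Lemma within_continuous_ccont (f : R -> C) :
  {within `[0, T], continuous f} <-> ccont T f.
Proof.
split=> [cf|[fr fi] t].
  by split=> t; have /cvg_complexP[] := cf t.
by apply/cvg_complexP; split; [exact: fr|exact: fi].
Qed.

Lemma cont_repP (u : L2 R) (f : R -> C) :
  cont_rep u f <-> ccont T f /\ {ae mu, forall x, 0 < x < T -> u x = f x}.
Proof.
have F := @ae_filter_ringOfSetsType _ _ _ mu.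
rewrite /cont_rep /= within_continuous_ccont; split=> -[cf fu]; split => //.
  by apply: filterS fu => x fu xT; rewrite fu// /I02pi /= in_itv.
by apply: filterS fu => x fu; rewrite /I02pi /= in_itv/= => /fu.
Qed.

Lemma cont_rep_unique (u : L2 R) (f g : R -> C) :
  cont_rep u f -> cont_rep u g -> forall x, 0 <= x <= T -> f x = g x.
Proof.
have F := @ae_filter_ringOfSetsType _ _ _ mu.
move=> /cont_repP[[fr fi] uf] /cont_repP[[gr gi] ug] x xT.
have fg : {ae mu, forall x, 0 < x < T -> f x = g x}.
  by apply: filterS2 uf ug => t h1 h2 tT; rewrite -h1// h2.
apply: eqC.
  apply: (@eq_itvcc_of_ae _ T (fun t => Re (f t)) (fun t => Re (g t))) => //.
    exact: twopi_gt0.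
  by apply: filterS fg => t h /h ->.
apply: (@eq_itvcc_of_ae _ T (fun t => Im (f t)) (fun t => Im (g t))) => //.
  exact: twopi_gt0.
by apply: filterS fg => t h /h ->.
Qed.

Lemma val_2piE (u : L2 R) (f : R -> C) : cont_rep u f -> val_2pi u = f T.
Proof.
move=> uf; have uv : cont_rep u (xget (cst 0) (cont_rep u)) by exact: xgetI uf.
by rewrite /val_2pi (cont_rep_unique uv uf)// lexx ltW// twopi_gt0.
Qed.

(** Integration by parts for the primitive V of [v] shows that p - V integrates to 0 against the
    derivative of every test function; du Bois-Reymond then makes it constant. *)
Lemma weak_prim (p v : R -> R) (S : R) : 0 < S ->
  {within `[0, S], continuous p} -> mu.-integrable `]0, S[ (EFin \o v) ->
  (forall phi dphi : R -> R, (forall x, is_derive x 1 phi (dphi x)) ->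
    continuous dphi ->
    (exists a b, [/\ 0 < a, b < S & forall x, ~~ (a <= x <= b) -> phi x = 0]) ->
    prim (fun t => p t * dphi t) S = - prim (fun t => v t * phi t) S) ->
  forall x, 0 <= x <= S -> p x = p 0 + prim v x.
Proof.
move=> S0 cp iv H x xS.
have cV := prim_continuous (ltW S0) iv.
have cw : {within `[0, S], continuous (fun t => p t - prim v t)}.
  by move=> t; apply: cvgB; [exact: cp|exact: cV].
have := du_bois_reymond S0 cw; rewrite prim0 subr0.
move=> /(_ _ _ xS) <-; first by rewrite subrK.
move=> phi dphi dp cd /[dup] supp [a [b [a0 bS phi0]]].
have cdS : {within `[0, S], continuous dphi} by exact: continuous_subspaceT.
have cphiS : {within `[0, S], continuous phi}.
  by apply: continuous_subspaceT; exact: is_derive_continuous dp.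
have S0S : 0 <= S <= S by rewrite lexx ltW.
have VE t : 0 <= t <= S -> prim v t = prim v 0 + prim v t.
  by rewrite prim0 add0r.
have := prim_by_parts (ltW S0) dp cd iv VE S0S.
rewrite prim0 mulr0 add0r phi0 ?mul0r; last by rewrite negb_and -!ltNge bS orbT.
rewrite prim_fctD; last 2 first.
- apply: integrableM_continuous => //; exact: continuous_integrable_oo.
- exact: integrableM_continuous.
have e1 : prim (fun t => p t * dphi t) S = - prim (fun t => v t * phi t) S.
  exact: H.
have e2 : prim (fun t => phi t * v t) S = prim (fun t => v t * phi t) S.
  by apply: prim_eq_fct => t _; rewrite mulrC.
have -> : prim (fun t => (p t - prim v t) * dphi t) S =
   prim (fun t => p t * dphi t) S - prim (fun t => dphi t * prim v t) S.
  rewrite -prim_fctB.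
  - by apply: prim_eq_fct => t _; ring.
  - apply: integrableM_continuous => //; exact: continuous_integrable_oo.
  - apply: integrableM_continuous => //; exact: continuous_integrable_oo.
by rewrite e1 e2 => /esym h; apply/eqP; rewrite -opprD oppr_eq0 [X in X == 0]addrC h.
Qed.

Lemma prim_weak (p v : R -> R) (S : R) : 0 < S ->
  mu.-integrable `]0, S[ (EFin \o v) ->
  (forall x, 0 <= x <= S -> p x = p 0 + prim v x) ->
  forall phi dphi : R -> R, (forall x, is_derive x 1 phi (dphi x)) ->
    continuous dphi -> phi 0 = 0 -> phi S = 0 ->
    prim (fun t => p t * dphi t) S = - prim (fun t => v t * phi t) S.
Proof.
move=> S0 iv pE phi dphi dp cd phi0 phiS.
have cdS : {within `[0, S], continuous dphi} by exact: continuous_subspaceT.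
have cphiS : {within `[0, S], continuous phi}.
  by apply: continuous_subspaceT; exact: is_derive_continuous dp.
have cp : {within `[0, S], continuous p}.
  have : {within `[0, S], continuous (fun x => p 0 + prim v x)}.
    by move=> z; apply: cvgD; [exact: cvg_cst|exact: (prim_continuous (ltW S0) iv)].
  by apply: subspace_eq_continuous => z; rewrite inE/= in_itv/= => /pE.
have S0S : 0 <= S <= S by rewrite lexx ltW.
have := prim_by_parts (ltW S0) dp cd iv pE S0S.
rewrite phi0 phiS !mul0r add0r prim_fctD; last 2 first.
- apply: integrableM_continuous => //; exact: continuous_integrable_oo.
- exact: integrableM_continuous.
have -> : prim (fun t => phi t * v t) S = prim (fun t => v t * phi t) S.
  by apply: prim_eq_fct => t _; rewrite mulrC.
have -> : prim (fun t => p t * dphi t) S = prim (fun t => dphi t * p t) S.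
  by apply: prim_eq_fct => t _; rewrite mulrC.
by move=> /esym/eqP; rewrite addr_eq0 => /eqP.
Qed.

Lemma weak_derivativeP (u v : L2 R) : weak_derivative u v <->
  forall phi dphi : R -> R, (forall x, is_derive x 1 phi (dphi x)) ->
    continuous dphi ->
    (exists a b, [/\ 0 < a, b < T & forall x, ~~ (a <= x <= b) -> phi x = 0]) ->
    prim (fun t => Re (u t) * dphi t) T = - prim (fun t => Re (v t) * phi t) T
    /\ prim (fun t => Im (u t) * dphi t) T = - prim (fun t => Im (v t) * phi t) T.
Proof.
have E (h : R -> R[i]) (p : R -> R) : cintegral (fun x => h x * (p x)%:C) =
    prim (fun t => Re (h t) * p t) T +i* prim (fun t => Im (h t) * p t) T.
  congr (_ +i* _); apply: eq_Rintegral => t _.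
    by rewrite ReM /= mulr0 subr0.
  by rewrite ImM /= mulr0 add0r.
have D (phi dphi : R -> R) : (forall x, is_derive x 1 phi (dphi x)) ->
    phi^`()%classic = dphi.
  by move=> d; apply/funext => x; rewrite derive1E; case: (d x).
split=> [uv phi dphi d cd supp|H phi [d cd supp]].
  have tphi : test_function phi.
    by split => //; rewrite (D _ _ d).
  have := uv _ tphi; rewrite (D _ _ d) !E.
  by move=> /eqP; rewrite eq_complex/= => /andP[/eqP ? /eqP ?].
have d' (x : R) : is_derive x 1 phi (phi^`()%classic x).
  by split; [exact: d|rewrite derive1E].
have [e1 e2] := H _ _ d' cd supp.
by rewrite !E e1 e2.
Qed.

Lemma cprim_ae_mul (u : L2 R) (f : R -> R[i]) (phi : R -> R) : ccont T f ->
  {ae mu, forall x, 0 < x < T -> u x = f x} -> continuous phi ->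
  prim (fun t => Re (f t) * phi t) T = prim (fun t => Re (u t) * phi t) T /\
  prim (fun t => Im (f t) * phi t) T = prim (fun t => Im (u t) * phi t) T.
Proof.
move=> cf uf.
have F := @ae_filter_ringOfSetsType _ _ _ mu.
move=> cphi.
have cphi' : {within `[0, T], continuous phi} by exact: continuous_subspaceT.
have cc : ccont T (fun t => (phi t)%:C).
  by split => //; move=> ?; exact: cvg_cst.
have : cprim (fun t => (phi t)%:C * f t) T = cprim (fun t => (phi t)%:C * u t) T.
  apply: cprim_ae => //.
  - exact/cintegrableM/ccont_cintegrable.
  - exact/cintegrableM/L2_cintegrable.
  - by apply: filterS uf => t h tT; rewrite h.
move=> -[e1 e2]; split.
  rewrite (@prim_eq_fct _ _ (fun t => Re ((phi t)%:C * f t))).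
    by rewrite e1; apply: prim_eq_fct => t _; rewrite ReM/=; ring.
  by move=> t _; rewrite ReM/=; ring.
rewrite (@prim_eq_fct _ _ (fun t => Im ((phi t)%:C * f t))).
  by rewrite e2; apply: prim_eq_fct => t _; rewrite ImM/=; ring.
by move=> t _; rewrite ImM/=; ring.
Qed.

(** With [cprim_weak_derivative], this identifies weak differentiability with absolute continuity.
    The continuous representative is taken as given because membership in the domain of [P1]
    provides one. *)
Lemma weak_derivative_cprim (u v : L2 R) (f : R -> C) :
  weak_derivative u v -> cont_rep u f ->
  forall x, 0 <= x <= T -> f x = f 0 + cprim v x.
Proof.
move=> /weak_derivativeP uv /cont_repP[cf uf] x xT.
have F := @ae_filter_ringOfSetsType _ _ _ mu.
have [fr fi] := cf.
have [vr vi] := L2_cintegrable v.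
apply: eqC; rewrite ReImE /=.
  apply: (@weak_prim (fun t => Re (f t)) (fun t => Re (v t)) T (twopi_gt0 R)) => //.
  move=> phi dphi d cd supp; have [-> _] := cprim_ae_mul cf uf cd.
  by have [] := uv _ _ d cd supp.
apply: (@weak_prim (fun t => Im (f t)) (fun t => Im (v t)) T (twopi_gt0 R)) => //.
move=> phi dphi d cd supp; have [_ ->] := cprim_ae_mul cf uf cd.
by have [] := uv _ _ d cd supp.
Qed.

Lemma cprim_weak_derivative (u v : L2 R) (f : R -> C) : cont_rep u f ->
  (forall x, 0 <= x <= T -> f x = f 0 + cprim v x) -> weak_derivative u v.
Proof.
move=> /cont_repP[cf uf] fE; apply/weak_derivativeP => phi dphi d cd.
move=> -[a [b [a0 bT phi0]]].
have [vr vi] := L2_cintegrable v.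
have p0 : phi 0 = 0 by rewrite phi0// negb_and -!ltNge a0.
have pT : phi T = 0 by rewrite phi0// negb_and -!ltNge bT orbT.
have [<- <-] := cprim_ae_mul cf uf cd.
split.
  apply: (@prim_weak (fun t => Re (f t)) _ _ (twopi_gt0 R)) => // x /fE e.
  by rewrite {1}e ReD.
apply: (@prim_weak (fun t => Im (f t)) _ _ (twopi_gt0 R)) => // x /fE e.
by rewrite {1}e ImD.
Qed.

(** [deriv_L2] picks some weak derivative. Two of them have the same primitives, namely f - f 0, so
    they agree almost everywhere and the choice is harmless. *)
Lemma deriv_L2E (u v : L2 R) (f : R -> C) : cont_rep u f ->
  (forall x, 0 <= x <= T -> f x = f 0 + cprim v x) -> deriv_L2 u = v.
Proof.
move=> uf fE; have uv := cprim_weak_derivative uf fE.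
have ud : weak_derivative u (deriv_L2 u) by exact: xgetI uv.
apply/L2_eqP; apply: cprim_eq_ae; try exact: L2_cintegrable.
move=> x xT; apply: (addrI (f 0)).
by rewrite -(weak_derivative_cprim ud uf)// fE.
Qed.

End WeakDerivatives.

(** * Solving (P1 - lam) u = h *)

Section ComplexExponential.
Variable R : realType.
Local Notation Re := (@complex.Re R).
Local Notation Im := (@complex.Im R).
Implicit Types (a b z : R[i]) (t : R).

Lemma cexpD a b : cexp (a + b) = cexp a * cexp b.
Proof.
by apply: eqC; rewrite ?ReImE /= !ReImE expRD ?cosD ?sinD; ring.
Qed.

Lemma cexp0 : cexp (0 : R[i]) = 1.
Proof. by apply: eqC; rewrite /= expR0 ?cos0 ?sin0 ?mulr1 ?mulr0. Qed.

Lemma cexpNM z : cexp (- z) * cexp z = 1.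
Proof. by rewrite -cexpD addNr cexp0. Qed.

Lemma is_derive_expMcos (a b x : R) :
  is_derive x 1 (fun t => expR (a * t) * cos (b * t))
    (a * (expR (a * x) * cos (b * x)) - b * (expR (a * x) * sin (b * x))).
Proof.
apply: is_derive_eq.
by rewrite /GRing.scale/=; ring.
Qed.

Lemma is_derive_expMsin (a b x : R) :
  is_derive x 1 (fun t => expR (a * t) * sin (b * t))
    (a * (expR (a * x) * sin (b * x)) + b * (expR (a * x) * cos (b * x))).
Proof. by apply: is_derive_eq; rewrite /GRing.scale/=; ring. Qed.

Lemma Re_cexpM z (t : R) :
  Re (cexp (z * t%:C)) = expR (Re z * t) * cos (Im z * t).
Proof. by rewrite /cexp /= !ReImE /= mulr0 subr0 mulr0 add0r. Qed.

Lemma Im_cexpM z (t : R) :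
  Im (cexp (z * t%:C)) = expR (Re z * t) * sin (Im z * t).
Proof. by rewrite /cexp /= !ReImE /= mulr0 subr0 mulr0 add0r. Qed.

Lemma cC1_cexp z :
  cC1 (fun t => cexp (z * t%:C)) (fun t => z * cexp (z * t%:C)).
Proof.
have eR : (fun t => Re (cexp (z * t%:C))) =
    fun t => expR (Re z * t) * cos (Im z * t).
  by apply/funext => t; rewrite Re_cexpM.
have eI : (fun t => Im (cexp (z * t%:C))) =
    fun t => expR (Re z * t) * sin (Im z * t).
  by apply/funext => t; rewrite Im_cexpM.
have cR : continuous (fun t => Re (cexp (z * t%:C))).
  by rewrite eR; apply: is_derive_continuous (is_derive_expMcos _ _).
have cI : continuous (fun t => Im (cexp (z * t%:C))).
  by rewrite eI; apply: is_derive_continuous (is_derive_expMsin _ _).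
split=> [x|x||].
- by rewrite eR ReM Re_cexpM Im_cexpM; exact: is_derive_expMcos.
- by rewrite eI ImM Re_cexpM Im_cexpM; exact: is_derive_expMsin.
- rewrite (_ : (fun t => _) = fun t => Re z * Re (cexp (z * t%:C)) -
      Im z * Im (cexp (z * t%:C))).
    by move=> t; apply: cvgB; apply: cvgM;
      solve [exact: cvg_cst|exact: cR|exact: cI].
  by apply/funext => t; rewrite ReM.
rewrite (_ : (fun t => _) = fun t => Re z * Im (cexp (z * t%:C)) +
    Im z * Re (cexp (z * t%:C))).
  by move=> t; apply: cvgD; apply: cvgM;
    solve [exact: cvg_cst|exact: cR|exact: cI].
by apply/funext => t; rewrite ImM.
Qed.

End ComplexExponential.

Section Resolution.
Variables (R : realType) (K : L2 R) (lam : R[i]).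
Local Notation mu := (@lebesgue_measure R).
Local Notation T := (2 * pi : R).
Implicit Types (c : R[i]) (u g h : L2 R) (x t : R).

Lemma L2_lin3_ae (a b c : R[i]) (u v w : L2 R) :
  {ae mu, forall x, 0 < x < T ->
    (a *: u + b *: v + c *: w : L2 R) x = a * u x + b * v x + c * w x}.
Proof.
have := pi_L2_ae (a *: repr u + b *: repr v + c *: repr w).
by rewrite !pi_L2D.
Qed.

Definition wave t : R[i] := cexp ('i * lam * t%:C).
Definition cowave t : R[i] := cexp (- ('i * lam) * t%:C).

Lemma cowaveK t : cowave t * wave t = 1.
Proof. by rewrite /cowave mulNr cexpNM. Qed.

Lemma wave0 : wave 0 = 1. Proof. by rewrite /wave mulr0 cexp0. Qed.
Lemma cowave0 : cowave 0 = 1. Proof. by rewrite /cowave mulr0 cexp0. Qed.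

Lemma wave_ccont S : ccont S wave.
Proof. exact: cC1_ccont (cC1_cexp _). Qed.

Lemma cowave_ccont S : ccont S cowave.
Proof. exact: cC1_ccont (cC1_cexp _). Qed.

(* Variation of constants: with f (2 pi) = c, the equation
   i f' + c K - lam f = h becomes (wave f)' = i wave (c K - h). *)
Definition duhamel c h x : R[i] :=
  c + cprim (fun t => wave t * ('i * (c * K t - h t))) x.

Definition resolves c u h : Prop :=
  {ae mu, forall x, 0 < x < T -> u x = cowave x * duhamel c h x} /\
  duhamel c h T = wave T * c.

Lemma duhamel_cintegrable c h :
  cintegrable T (fun t => wave t * ('i * (c * K t - h t))).
Proof.
apply: cintegrableM; first exact: wave_ccont.
apply: cintegrableZ.
apply: (@eq_cintegrable _ _ (fun t => c * K t + (-1) * h t)).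
  by move=> t; rewrite mulN1r.
by apply: cintegrableD; apply: cintegrableZ; exact: L2_cintegrable.
Qed.

Lemma shift_P1P c u h :
  [/\ dom (P1 K) u, op_shift (P1 K) lam u = h & val_2pi u = c] <->
  resolves c u h.
Proof.
have F := @ae_filter_ringOfSetsType _ _ _ mu.
have ii : 'i * 'i = -1 :> R[i] by rewrite -expr2 sqr_i.
have TT : 0 <= T <= T by rewrite lexx twopi_ge0.
split.
  case=> -[[v0 uv0] [f uf f0T]] uh uc.
  have uv : weak_derivative u (deriv_L2 u) by exact: xgetI uv0.
  move: uh; rewrite /op_shift /P1 /= uc; set v := deriv_L2 u in uv * => uh.
  have fT : f T = c by rewrite -(val_2piE uf).
  have fE := weak_derivative_cprim uv uf.
  have [cf uf'] := (cont_repP _ _).1 uf.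
  have hE : {ae mu, forall x, 0 < x < T ->
      h x = 'i * v x + c * K x - lam * u x}.
    have := L2_lin3_ae 'i c (- lam) v K u.
    rewrite scaleNr uh; apply: filterS => x h1 /h1 ->.
    by rewrite mulNr.
  (* The density of wave f is wave (i lam f + v), and solving h = i v + c K - lam u gives i (c K -
     h) = v + i lam u. *)
  have W x : 0 <= x <= T -> duhamel c h x = wave x * f x.
    move=> xT; have iv := L2_cintegrable v.
    rewrite (cprim_by_parts (twopi_ge0 R) (cC1_cexp _) iv fE xT) -/(wave _) wave0 mul1r.
    rewrite f0T fT; congr (_ + _).
    apply: cprim_ae; first by case/andP: xT.
    - exact: duhamel_cintegrable.
    - apply: cintegrableD.
        apply/ccont_cintegrable/ccontM => //.
        by apply: ccontM; [exact: ccont_cst|exact: wave_ccont].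
      by apply: cintegrableM => //; exact: wave_ccont.
    - apply: filterS2 uf' hE => t ut ht tT; rewrite ht// -ut// -/(wave t).
      apply/eqP; rewrite -subr_eq0.
      rewrite (_ : _ - _ = - ('i * 'i + 1) * wave t * v t); last by ring.
      by rewrite ii addNr oppr0 !mul0r.
  split; last by rewrite W ?fT.
  apply: filterS uf' => x ux xT; rewrite W.
    by rewrite mulrA cowaveK mul1r ux.
  by case/andP: xT => x0 x1; rewrite !ltW.
move=> [uE WT].
pose W := duhamel c h.
have W0 : W 0 = c by rewrite /W /duhamel cprim0 addr0.
have cW : ccont T W.
  apply: ccontD; first exact: ccont_cst.
  by apply: cprim_ccont; [exact: twopi_ge0|exact: duhamel_cintegrable].
pose f x := cowave x * W x.
have cf : ccont T f by apply: ccontM => //; exact: cowave_ccont.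
have uf : cont_rep u f by apply/cont_repP.
have f0 : f 0 = c by rewrite /f cowave0 W0 mul1r.
have fT : f T = c by rewrite /f /W WT mulrA cowaveK mul1r.
(* The only possible derivative: the solution of i v + c K - lam u = h for [v]. *)
pose v : L2 R := (- ('i * lam)) *: u + ('i * c) *: K + (- 'i) *: h.
have vE := L2_lin3_ae (- ('i * lam)) ('i * c) (- 'i) u K h.
have WE x : 0 <= x <= T ->
    W x = W 0 + cprim (fun t => wave t * ('i * (c * K t - h t))) x.
  by rewrite W0.
have fE x : 0 <= x <= T -> f x = f 0 + cprim v x.
  move=> xT.
  rewrite /f (cprim_by_parts (twopi_ge0 R) (cC1_cexp (- ('i * lam))) (duhamel_cintegrable c h) WE xT).
  congr (_ + _); apply: cprim_ae; first by case/andP: xT.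
  - apply: cintegrableD.
      apply/ccont_cintegrable/ccontM => //.
      by apply: ccontM; [exact: ccont_cst|exact: cowave_ccont].
    by apply: cintegrableM; [exact: cowave_ccont|exact: duhamel_cintegrable].
  - exact: L2_cintegrable.
  apply: filterS2 uE vE => t ut vt tT; rewrite vt// ut// -/(cowave t) -/W.
  by rewrite [X in _ + X]mulrA cowaveK; ring.
have dv : deriv_L2 u = v by exact: deriv_L2E uf fE.
have uc : val_2pi u = c by rewrite (val_2piE uf).
split => //.
  split; first by exists v; exact: cprim_weak_derivative uf fE.
  by exists f => //; rewrite f0 fT.
rewrite /op_shift /P1 /= uc dv /v !scalerDr !scalerA.
rewrite !mulrN !mulrA ii !mulN1r !opprK scaleNr scale1r.
by rewrite (addrAC _ h) subrK (addrC (lam *: u)) addrK.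
Qed.

End Resolution.

(** * Root spaces spanned by a Jordan chain *)

Section RootSpaceOfChain.
Variables (K : fieldType) (V : lmodType K) (A : operator V) (z : K).
Variables (S : K -> V -> V -> Prop) (e : nat -> V) (m : nat).
(** [S c u h] abstracts the equation (A - z) u = h with boundary parameter c. By [S_inj] the
    parameter determines a solution of the homogeneous equation, so the kernel of A - z is at most
    one-dimensional. [chain_nil] and [chain_end] say that the chain is maximal; [chain_end] treats
    only parameter 0, since any other parameter can be removed by subtracting a multiple of
    [e 0]. *)
Hypothesis SP : forall u h, (dom A u /\ op_shift A z u = h) <-> exists c, S c u h.
Hypothesis S_lin : forall a c c' u u' h h', S c u h -> S c' u' h' ->
  S (a * c + c') (a *: u + u') (a *: h + h').
Hypothesis S_zero : S 0 0 0.
Hypothesis S_param : forall c h, S c 0 h -> c = 0.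
Hypothesis S_inj : forall u, S 0 u 0 -> u = 0.
Hypothesis chain0 : (0 < m)%N -> S 1 (e 0) 0.
Hypothesis chainS : forall j, (j.+1 < m)%N -> S 0 (e j.+1) (e j).
Hypothesis chain_nil : m = 0%N -> forall c u, S c u 0 -> c = 0.
Hypothesis chain_end : forall k, m = k.+1 ->
  forall u a, S 0 u (a *: e k) -> a = 0.

Let N j v := dom (op_pow (op_shift A z) j) v /\ op_pow (op_shift A z) j v = 0.

Let N0 v : N 0 v <-> v = 0.
Proof. by split=> [[]|->]. Qed.

Let NS j v : N j.+1 v <-> dom A v /\ N j (op_shift A z v).
Proof.
split=> [[dv vj]|[dv [dj vj]]].
  split; first exact: (dv 0%N).
  split; last by move: vj; rewrite /= -iterSr.
  by move=> i ij; have := dv i.+1 ij; rewrite /= -iterSr.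
split; last by rewrite /= -[RHS]vj /= -iterSr.
by move=> [|i] ij //; have := dj i ij; rewrite /= -iterSr.
Qed.

Let S_fun c c' u h h' : S c u h -> S c' u h' -> h = h'.
Proof.
move=> s s'; have [_ <-] := (SP u h).2 (ex_intro _ c s).
by have [_ <-] := (SP u h').2 (ex_intro _ c' s').
Qed.

Let S_sum n (d : nat -> K) : (n.+1 <= m)%N ->
  S 0 (\sum_(i < n) d i *: e i.+1) (\sum_(i < n) d i *: e i).
Proof.
elim: n => [|n IH] nm; first by rewrite !big_ord0.
rewrite !big_ord_recr/= addrC [X in S _ _ X]addrC.
rewrite -[X in S X](_ : d n * 0 + 0 = 0); last by rewrite mulr0 addr0.
by apply: S_lin; [exact: chainS|exact: IH (ltnW nm)].
Qed.

Let S_chain n (d : nat -> K) : (n.+1 <= m)%N ->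
  S (d 0) (\sum_(i < n.+1) d i *: e i) (\sum_(i < n) d i.+1 *: e i).
Proof.
move=> nm; rewrite big_ord_recl/=.
have m0 : (0 < m)%N by exact: (leq_ltn_trans (leq0n n)).
have := S_lin (d 0%N) (chain0 m0) (S_sum (fun i => d i.+1) nm).
by rewrite mulr1 addr0 scaler0 add0r.
Qed.

(** By induction (A - z) v lies in the span. Subtracting from v the combination with the same
    parameter and the coefficients shifted up by one leaves a w with parameter 0 and (A - z) w a
    multiple of the last chain vector; maximality makes that multiple 0, and injectivity gives w =
    0. *)
Let N_span j v : N j v -> exists d : nat -> K, v = \sum_(i < m) d i *: e i.
Proof.
elim: j v => [v /N0 ->|j IH v /NS[dv /IH[d gd]]].
  by exists (fun=> 0); rewrite big1// => i _; rewrite scale0r.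
have [c Sv] := (SP v _).1 (conj dv gd).
case Em: m => [|k].
  have c0 : c = 0.
    by apply: (@chain_nil Em c v); move: Sv; rewrite Em big_ord0.
  exists d; rewrite big_ord0; apply: S_inj.
  by move: Sv; rewrite c0 Em big_ord0.
(* The shifted coefficients: the parameter [c] becomes the coefficient of [e 0], the only chain
   vector with a nonzero parameter. *)
pose d' i := if i is j.+1 then d j else c.
have := @S_chain k d'; rewrite Em leqnn => /(_ isT) S'.
move: Sv; rewrite Em big_ord_recr/= => Sv.
have := S_lin (-1) S' Sv.
rewrite /= mulN1r addNr !scaleN1r addrA addNr add0r => Sw.
have dk := chain_end Em Sw.
move: Sw; rewrite dk scale0r => /S_inj /eqP.
by rewrite addrC subr_eq0 => /eqP ->; exists d'.
Qed.

Let span_N n (d : nat -> K) : (n <= m)%N -> N n (\sum_(i < n) d i *: e i).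
Proof.
elim: n d => [|n IH] d nm; first by apply/N0; rewrite big_ord0.
have [dv sv] := (SP _ _).2 (ex_intro _ _ (S_chain d nm)).
by apply/NS; split => //; rewrite sv; apply: (IH (fun i => d i.+1)); exact: ltnW.
Qed.

(** The parameter of a combination is its coefficient [d 0], and A - z shifts the remaining ones
    down. A vanishing combination thus has [d 0 = 0] and a vanishing shifted combination. *)
Let indep n (d : nat -> K) : (n <= m)%N ->
  \sum_(i < n) d i *: e i = 0 -> forall i, (i < n)%N -> d i = 0.
Proof.
elim: n d => [//|n IH] d nm d0.
have := S_chain d nm; rewrite d0 => S0.
have dz := S_param S0.
have := S_fun S0 S_zero => /(IH (fun i => d i.+1)) IH'.
by case=> [//|i] ilt; apply: IH' => //; exact: ltnW.
Qed.

Lemma root_space_of_chain : alg_multiplicity_is A z m.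
Proof.
pose ext (c : 'I_m -> K) i := if insub i is Some k then c k else 0.
have extE c : \sum_(i < m) c i *: e i = \sum_(i < m) ext c i *: e i.
  by apply: eq_bigr => i _; rewrite /ext valK.
exists (fun i : 'I_m => e i); split.
  move=> c; rewrite extE => /(indep (leqnn _)) h i.
  by have := h i (ltn_ord i); rewrite /ext valK.
apply/seteqP; split=> [v [j /N_span[d ->]]|v [c _ <-]].
  by exists (fun i => d i).
by exists m; rewrite extE; exact: span_N.
Qed.

End RootSpaceOfChain.

(** * The Jordan chain of P1 *)

Section Chain.
Variables (R : realType) (K : L2 R) (lam : R[i]).
Local Notation mu := (@lebesgue_measure R).
Local Notation T := (2 * pi : R).
Local Notation wave := (wave lam).
Local Notation cowave := (cowave lam).
Local Notation resolves := (resolves K lam).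
Implicit Types (a c : R[i]) (u g h : L2 R) (x t : R).

Lemma L2_0_ae : {ae mu, forall x, 0 < x < T -> (0 : L2 R) x = 0}.
Proof.
have F := @ae_filter_ringOfSetsType _ _ _ mu.
have := L2_lin_ae (-1) 0 (0 : L2 R).
rewrite scaler0 addr0; apply: filterS => x h /h.
by rewrite mulN1r addNr.
Qed.

Lemma duhamel_lin a c c' h h' x : x <= T ->
  duhamel K lam (a * c + c') (a *: h + h') x = a * duhamel K lam c h x + duhamel K lam c' h' x.
Proof.
move=> xT; have F := @ae_filter_ringOfSetsType _ _ _ mu.
rewrite /duhamel mulrDr addrACA; congr (_ + _).
have i1 := cintegrable_le xT (duhamel_cintegrable K lam c h).
have i2 := cintegrable_le xT (duhamel_cintegrable K lam c' h').
rewrite -cprimZ// -cprimD//; last exact: cintegrableZ.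
apply: cprim_ae => //; first exact: duhamel_cintegrable.
  by apply: cintegrableD; [apply: cintegrableZ|]; exact: duhamel_cintegrable.
by apply: filterS (L2_lin_ae a h h') => t ht tT; rewrite ht//; ring.
Qed.

Lemma duhamel00 x : x <= T -> duhamel K lam 0 0 x = 0.
Proof.
move=> xT; have := duhamel_lin (-1) 0 0 0 0 xT.
by rewrite scaler0 !mulr0 !addr0 mulN1r addNr.
Qed.

Lemma resolves_lin a c c' u u' h h' : resolves c u h -> resolves c' u' h' ->
  resolves (a * c + c') (a *: u + u') (a *: h + h').
Proof.
have F := @ae_filter_ringOfSetsType _ _ _ mu.
move=> [uE cE] [uE' cE']; split; last by rewrite duhamel_lin// cE cE'; ring.
apply: filterS (filterI uE (filterI uE' (L2_lin_ae a u u'))).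
move=> x [ux [ux' uux]] xT; rewrite uux// ux// ux'// duhamel_lin; first by ring.
by case/andP: xT => _ /ltW.
Qed.

Lemma resolves_zero : resolves 0 0 0.
Proof.
have F := @ae_filter_ringOfSetsType _ _ _ mu.
split; last by rewrite duhamel00// mulr0.
apply: filterS L2_0_ae => x x0 xT; rewrite x0// duhamel00 ?mulr0//.
by case/andP: xT => _ /ltW.
Qed.

(** The parameter is the boundary value of the solution, so the zero vector can only have parameter
    0. *)
Lemma resolves_param c h : resolves c 0 h -> c = 0.
Proof.
move=> /shift_P1P[_ _ <-].
by have /shift_P1P[] := resolves_zero.
Qed.

Lemma resolves_inj u : resolves 0 u 0 -> u = 0.
Proof.
have F := @ae_filter_ringOfSetsType _ _ _ mu.
move=> [uE _]; apply/L2_eqP; apply: filterS2 uE L2_0_ae => x ux x0 xT.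
rewrite x0// ux// duhamel00 ?mulr0//.
by case/andP: xT => _ /ltW.
Qed.

Lemma shift_P1_resolves u h :
  (dom (P1 K) u /\ op_shift (P1 K) lam u = h) <-> exists c, resolves c u h.
Proof.
split=> [[du uh]|[c /shift_P1P[]]//].
by exists (val_2pi u); apply/shift_P1P.
Qed.

(* The chain consists of [u_j = cowave * chain_fun j], with
   [u_0(2 pi) = 1] and [(P1 - lam) u_(j + 1) = u_j]. *)
Fixpoint chain_fun (j : nat) : R -> R[i] :=
  if j is k.+1 then fun x => cprim (fun t => - 'i * chain_fun k t) x
  else duhamel K lam 1 0.

Lemma duhamel_ccont c h : ccont T (duhamel K lam c h).
Proof.
apply: ccontD; first exact: ccont_cst.
by apply: cprim_ccont; [exact: twopi_ge0|exact: duhamel_cintegrable].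
Qed.

Lemma chain_fun_ccont j : ccont T (chain_fun j).
Proof.
elim: j => [|j IH]; first exact: duhamel_ccont.
apply: cprim_ccont; first exact: twopi_ge0.
exact/cintegrableZ/ccont_cintegrable.
Qed.

Lemma chain_exists : exists e : nat -> L2 R, forall j,
  {ae mu, forall x, 0 < x < T -> e j x = cowave x * chain_fun j x}.
Proof.
suff /choice[e eE] : forall j, exists u : L2 R,
    {ae mu, forall x, 0 < x < T -> u x = cowave x * chain_fun j x}.
  by exists e.
move=> j; apply: L2_of_sq_integrable; apply: ccont_sq_integrable.
by apply: ccontM; [exact: cowave_ccont|exact: chain_fun_ccont].
Qed.

Lemma duhamel_chain (u : L2 R) j x : x <= T ->
  {ae mu, forall x, 0 < x < T -> u x = cowave x * chain_fun j x} ->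
  duhamel K lam 0 u x = chain_fun j.+1 x.
Proof.
move=> xT uE; have F := @ae_filter_ringOfSetsType _ _ _ mu.
rewrite /duhamel add0r; apply: cprim_ae => //.
- exact: duhamel_cintegrable.
- exact/cintegrableZ/ccont_cintegrable/chain_fun_ccont.
apply: filterS uE => t ut tT; rewrite ut//.
have -> : wave t * ('i * (0 * K t - cowave t * chain_fun j t)) =
  (cowave t * wave t) * (- 'i * chain_fun j t) by ring.
by rewrite cowaveK mul1r.
Qed.

(** The failure of the closing condition, whose parameter c is 1 at index 0 and 0 afterwards. *)
Definition chain_defect j : R[i] := chain_fun j T - (j == 0)%:R * wave T.

Lemma alg_multiplicity_of_chain m :
  (forall j, (j < m)%N -> chain_defect j = 0) -> chain_defect m != 0 ->
  alg_multiplicity_is (P1 K) lam m.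
Proof.
move=> dj dm; have [e eE] := chain_exists.
have dS j : chain_defect j.+1 = chain_fun j.+1 T.
  by rewrite /chain_defect mul0r subr0.
apply: (root_space_of_chain (S := resolves) (e := e)).
- exact: shift_P1_resolves.
- exact: resolves_lin.
- exact: resolves_zero.
- exact: resolves_param.
- exact: resolves_inj.
- move=> m0; split; first exact: (eE 0%N).
  apply/eqP; rewrite mulr1 -subr_eq0; apply/eqP.
  by have := dj 0%N m0; rewrite /chain_defect mul1r.
- move=> j jm; split.
    have F := @ae_filter_ringOfSetsType _ _ _ mu.
    apply: filterS (eE j.+1) => x ex xT; rewrite ex//.
    rewrite (duhamel_chain _ (eE j))//.
    by case/andP: xT => _ /ltW.
  by rewrite (duhamel_chain _ (eE j))// -dS dj// mulr0.
(* By linearity the closing condition for parameter [c] and right-hand side 0 reads c times the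
   defect of index 0 equals 0. *)
- move=> m0 c u [_]; move: dm; rewrite m0 /chain_defect mul1r => dm.
  have := duhamel_lin c 1 0 0 0 (lexx T).
  rewrite scaler0 mulr1 !addr0 duhamel00// addr0 => ->.
  move=> /eqP; rewrite -subr_eq0 [wave T * c]mulrC -mulrBr mulf_eq0 (negbTE dm) orbF.
  by move=> /eqP.
(* Here the closing condition says that [a] times the defect of index k + 1 = m is 0. *)
- move=> k mk u a [_]; move: dm; rewrite mk dS => dm.
  have := duhamel_lin a 0 0 (e k) 0 (lexx T).
  rewrite mulr0 !addr0 duhamel00// addr0 => ->.
  rewrite (duhamel_chain _ (eE k))// mulr0 => /eqP.
  by rewrite mulf_eq0 (negbTE dm) orbF => /eqP.
Qed.

End Chain.

(** * Moments *)

Section Moments.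
Variables (R : realType) (K : L2 R) (lam : R[i]).
Local Notation mu := (@lebesgue_measure R).
Local Notation T := (2 * pi : R).
Local Notation wave := (wave lam).
Local Notation chain_fun := (chain_fun K lam).
Implicit Types (x t : R).

(** The kernel of Cauchy's formula for repeated integration. The division by k! makes the derivative
    of each weight exactly minus the previous one. *)
Definition taylor_weight k t : R := (T - t) ^+ k / k`!%:R.

Lemma is_derive_taylor_weight k x :
  is_derive x 1 (taylor_weight k.+1) (- taylor_weight k x).
Proof.
have -> : taylor_weight k.+1 =
    (k.+1`!%:R)^-1 \*: ((cst T - id : R -> R) ^+ k.+1).
  by apply/funext => t; rewrite /taylor_weight exprfctE mulrC.
apply: is_derive_eq.
rewrite /GRing.scale/= /taylor_weight factS natrM.
have k0 : k.+1%:R != 0 :> R by rewrite pnatr_eq0.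
have f0 : k`!%:R != 0 :> R by rewrite pnatr_eq0 -lt0n fact_gt0.
rewrite !addrfctE !opprfctE /cst/=.
by field; rewrite f0 addrC natr1.
Qed.

Lemma continuous_taylor_weight k : continuous (taylor_weight k).
Proof.
case: k => [|k].
  rewrite /taylor_weight (_ : (fun t => _) = fun=> (0`!%:R)^-1).
    by move=> t; exact: cvg_cst.
  by apply/funext => t; rewrite expr0 mul1r.
exact: is_derive_continuous (is_derive_taylor_weight k).
Qed.

Lemma cC1_taylor_weight k : cC1 (fun t => (taylor_weight k.+1 t)%:C)
  (fun t => (- taylor_weight k t)%:C).
Proof.
split=> [x|x||] /=.
- exact: is_derive_taylor_weight.
- exact: is_derive_cst.
- by move=> t; apply: cvgN; exact: continuous_taylor_weight.
- by move=> t; exact: cvg_cst.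
Qed.

Definition chain_moment k j : R[i] :=
  cprim (fun t => (taylor_weight k t)%:C * chain_fun j t) T.

Lemma taylor_weight_ccont k : ccont T (fun t => (taylor_weight k t)%:C).
Proof.
split; last by move=> t; exact: cvg_cst.
exact/continuous_subspaceT/continuous_taylor_weight.
Qed.

Lemma wK_cintegrable : cintegrable T (fun t => wave t * K t).
Proof.
by apply: cintegrableM; [exact: wave_ccont|exact: L2_cintegrable].
Qed.

Lemma taylor_weightT k : taylor_weight k.+1 T = 0.
Proof. by rewrite /taylor_weight subrr expr0n mul0r. Qed.

Lemma taylor_weight0 k : taylor_weight k 0 = T ^+ k / k`!%:R.
Proof. by rewrite /taylor_weight subr0. Qed.

Lemma moment_by_parts k (v F : R -> R[i]) : cintegrable T v ->
  (forall x, 0 <= x <= T -> F x = F 0 + cprim v x) -> ccont T F ->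
  cprim (fun t => (taylor_weight k t)%:C * F t) T =
  (taylor_weight k.+1 0)%:C * F 0 +
    cprim (fun t => (taylor_weight k.+1 t)%:C * v t) T.
Proof.
move=> iv FE cF.
have TT : 0 <= T <= T by rewrite lexx twopi_ge0.
have := cprim_by_parts (twopi_ge0 R) (cC1_taylor_weight k) iv FE TT.
rewrite taylor_weightT mul0r cprimD; last 2 first.
- apply/ccont_cintegrable/ccontM => //.
  exact: cC1_ccontD (cC1_taylor_weight k).
- by apply: cintegrableM => //; exact: taylor_weight_ccont.
have -> : cprim (fun t => (- taylor_weight k t)%:C * F t) T =
    - cprim (fun t => (taylor_weight k t)%:C * F t) T.
  rewrite -mulN1r -cprimZ.
    by apply: eq_cprim => t _; rewrite mulN1r rmorphN mulNr.
  by apply/ccont_cintegrable/ccontM => //; exact: taylor_weight_ccont.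
by move=> /esym/eqP; rewrite addrCA addrC subr_eq0 => /eqP.
Qed.

(** One integration by parts trades an integration in the chain for one more power in the weight.
    Both boundary terms vanish: the weight at 2 pi, and [chain_fun j.+1] at 0. *)
Lemma chain_momentS k j : chain_moment k j.+1 = - 'i * chain_moment k.+1 j.
Proof.
rewrite /chain_moment (@moment_by_parts _ (fun t => - 'i * chain_fun j t)).
- rewrite [X in _ * X](_ : _ = 0) ?mulr0 ?add0r; last exact: cprim0.
  rewrite -cprimZ; last first.
    apply/ccont_cintegrable/ccontM; first exact: taylor_weight_ccont.
    exact: chain_fun_ccont.
  by apply: eq_cprim => t _; rewrite mulrCA.
- exact/cintegrableZ/ccont_cintegrable/chain_fun_ccont.
- by move=> x _; rewrite [X in X + _](_ : _ = 0) ?add0r//; exact: cprim0.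
- exact: chain_fun_ccont.
Qed.

Lemma chain_moment0 k : chain_moment k 0 = (taylor_weight k.+1 0)%:C +
  'i * cprim (fun t => (taylor_weight k.+1 t)%:C * (wave t * K t)) T.
Proof.
have F := @ae_filter_ringOfSetsType _ _ _ mu.
rewrite /chain_moment (@moment_by_parts _ _ _ (duhamel_cintegrable K lam 1 0)).
- congr (_ + _); first by rewrite /= /duhamel cprim0 addr0 mulr1.
  rewrite -cprimZ; last first.
    by apply: cintegrableM; [exact: taylor_weight_ccont|exact: wK_cintegrable].
  apply: cprim_ae => //.
  + by apply: cintegrableM; [exact: taylor_weight_ccont|exact: duhamel_cintegrable].
  + apply: cintegrableZ.
    by apply: cintegrableM; [exact: taylor_weight_ccont|exact: wK_cintegrable].
  by apply: filterS (L2_0_ae R) => t t0 tT; rewrite t0//; ring.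
- by move=> x _; rewrite /= /duhamel cprim0 addr0.
- exact: chain_fun_ccont.
Qed.

Lemma chain_moment_shift k j :
  chain_moment k j = (- 'i) ^+ j * chain_moment (k + j) 0.
Proof.
elim: j k => [|j IH] k; first by rewrite expr0 mul1r addn0.
by rewrite chain_momentS IH mulrA -exprS addSnnS.
Qed.

(* Up to the factor i^k, the k-th derivative of Phi at lam is the value of this
   functional at 'X^k. *)
Definition Phi_moment (p : {poly R[i]}) : R[i] :=
  p.[0] - p.[T%:C] * wave T + 'i * cprim (fun t => p.[t%:C] * (wave t * K t)) T.

Lemma horner_ccont (p : {poly R[i]}) S : ccont S (fun t => p.[t%:C]).
Proof.
elim/poly_ind: p => [|p c IH].
  by apply: (@eq_ccont _ _ (fun=> 0)) => [t _|]; [rewrite horner0|exact: ccont_cst].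
apply: (@eq_ccont _ _ (fun t => p.[t%:C] * t%:C + c)).
  by move=> t _; rewrite hornerMXaddC.
apply: ccontD; last exact: ccont_cst.
apply: ccontM => //; split; last by move=> t; exact: cvg_cst.
by apply: continuous_subspaceT => t; exact: cvg_id.
Qed.

Lemma Phi_moment_lin (a : R[i]) (p q : {poly R[i]}) : Phi_moment (a *: p + q) = a * Phi_moment p + Phi_moment q.
Proof.
rewrite /Phi_moment !(hornerD, hornerZ).
have -> : cprim (fun t => (a *: p + q).[t%:C] * (wave t * K t)) T =
    a * cprim (fun t => p.[t%:C] * (wave t * K t)) T +
    cprim (fun t => q.[t%:C] * (wave t * K t)) T.
  have i r : cintegrable T (fun t => r.[t%:C] * (wave t * K t)).
    by apply: cintegrableM; [exact: horner_ccont|exact: wK_cintegrable].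
  rewrite -cprimZ// -cprimD//; last exact: cintegrableZ.
  by apply: eq_cprim => t _; rewrite hornerD hornerZ mulrDl -mulrA.
by ring.
Qed.

Lemma horner_taylor_weight (k : nat) t :
  ((T%:C%:P - 'X : {poly R[i]}) ^+ k).[t%:C] = k`!%:R * (taylor_weight k t)%:C.
Proof.
have f0 : k`!%:R != 0 :> R by rewrite pnatr_eq0 -lt0n fact_gt0.
rewrite horner_exp hornerD hornerN hornerC hornerX /taylor_weight.
rewrite -(rmorph_nat (real_complex R) k`!) -(rmorphM (real_complex R)).
rewrite (mulrC k`!%:R) divfK//.
by rewrite (rmorphXn (real_complex R)) (rmorphB (real_complex R)).
Qed.

Lemma Phi_moment_rev k : Phi_moment ((T%:C%:P - 'X) ^+ k) = k`!%:R *
  ((taylor_weight k 0)%:C - (taylor_weight k T)%:C * wave T +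
   'i * cprim (fun t => (taylor_weight k t)%:C * (wave t * K t)) T).
Proof.
rewrite /Phi_moment !horner_taylor_weight.
rewrite (@eq_cprim _ _ (fun t =>
  k`!%:R * ((taylor_weight k t)%:C * (wave t * K t)))); last first.
  by move=> t _; rewrite horner_taylor_weight mulrA.
rewrite cprimZ; last first.
  by apply: cintegrableM; [exact: taylor_weight_ccont|exact: wK_cintegrable].
by ring.
Qed.

Lemma chain_defectE j :
  j`!%:R * chain_defect K lam j = (- 'i) ^+ j * Phi_moment ((T%:C%:P - 'X) ^+ j).
Proof.
rewrite Phi_moment_rev mulrCA; congr (_ * _).
(* Index 0 stands apart: its weight is 1 at 2 pi, so the term with [wave T] survives, whereas all
   later weights vanish there. *)
rewrite /chain_defect; case: j => [|j].
  have tw t : (taylor_weight 0 t)%:C = 1 by rewrite /taylor_weight expr0 fact0 divr1.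
  rewrite expr0 !mul1r !tw mul1r.
  rewrite [RHS]addrAC; congr (_ - _); rewrite /= /duhamel.
  have F := @ae_filter_ringOfSetsType _ _ _ mu.
  congr (_ + _); rewrite -cprimZ; last first.
    apply: (eq_cintegrable _ wK_cintegrable) => t.
    by rewrite mul1r.
  apply: cprim_ae => //; first exact: duhamel_cintegrable.
    apply: cintegrableZ; apply: (eq_cintegrable _ wK_cintegrable) => t.
    by rewrite mul1r.
  by apply: filterS (L2_0_ae R) => t t0 tT; rewrite t0//; ring.
rewrite mul0r subr0 taylor_weightT mul0r subr0 -chain_moment0.
rewrite exprS -mulrA -(chain_moment_shift 0 j) /= cprimZ; last first.
  exact/ccont_cintegrable/chain_fun_ccont.
congr (_ * _); apply: eq_cprim => t _.
by rewrite /taylor_weight expr0 fact0 divr1 mul1r.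
Qed.

End Moments.

(** * The first nonvanishing moment *)

Section MomentOrder.
Variables (R : realType) (K : L2 R) (lam : R[i]).
Local Notation mu := (@lebesgue_measure R).
Local Notation T := (2 * pi : R).
Local Notation Phi_moment := (Phi_moment K lam).
Local Notation rev k := ((T%:C%:P - 'X : {poly R[i]}) ^+ k).

Lemma Phi_moment0 : Phi_moment 0 = 0.
Proof.
have := Phi_moment_lin K lam (-1) 0 0.
by rewrite scaler0 addr0 mulN1r addNr.
Qed.

Lemma Phi_moment_sum n (a : nat -> R[i]) (p : nat -> {poly R[i]}) :
  Phi_moment (\sum_(i < n) a i *: p i) = \sum_(i < n) a i * Phi_moment (p i).
Proof.
elim: n => [|n IH]; first by rewrite !big_ord0 Phi_moment0.
by rewrite !big_ord_recr/= addrC Phi_moment_lin IH addrC.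
Qed.

(** In the binomial expansion of (2 pi - X)^k only the leading monomial escapes the hypothesis, and
    its coefficient is the unit (-1)^k. *)
Lemma Phi_moment_rev_low k : (forall j, (j < k)%N -> Phi_moment 'X^j = 0) ->
  Phi_moment (rev k) = (-1) ^+ k * Phi_moment 'X^k.
Proof.
move=> lowk.
have -> : rev k = \sum_(i < k.+1)
    (((-1) ^+ i * T%:C ^+ (k - i)) *+ 'C(k, i)) *: 'X^i.
  rewrite exprBn; apply: eq_bigr => i _.
  by rewrite -scalerMnl -mul_polyC polyCM !polyC_exp polyCN polyC1.
rewrite (Phi_moment_sum _ (fun i => ((-1) ^+ i * T%:C ^+ (k - i)) *+ 'C(k, i)) (fun i => 'X^i)).
rewrite big_ord_recr/= big1 ?add0r; last by move=> i _; rewrite lowk ?mulr0.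
by rewrite subnn expr0 mulr1 binn.
Qed.

Lemma Phi_moment_monomials m : (forall j, (j < m)%N -> Phi_moment (rev j) = 0) ->
  (forall j, (j < m)%N -> Phi_moment 'X^j = 0) /\ Phi_moment 'X^m = (-1) ^+ m * Phi_moment (rev m).
Proof.
move=> lowm.
have E k : (k <= m)%N -> forall j, (j < k)%N -> Phi_moment 'X^j = 0.
  elim: k => [//|k IH] km j; rewrite ltnS leq_eqVlt => /predU1P[->|].
    have := Phi_moment_rev_low (IH (ltnW km)); rewrite lowm// => /esym/eqP.
    by rewrite mulf_eq0 signr_eq0 => /eqP.
  exact/IH/ltnW.
split; first exact: E.
by rewrite (Phi_moment_rev_low (E m (leqnn m))) mulrA -expr2 sqrr_sign mul1r.
Qed.

(** Dominated convergence: on the open interval 0 < 1 - t / T < 1, so the powers tend to 0 pointwise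
    and |g| dominates. *)
Lemma prim_decay (g : R -> R) : mu.-integrable `]0, T[ (EFin \o g) ->
  (fun n => prim (fun t => (1 - t / T) ^+ n * g t) T) @ \oo --> (0 : R).
Proof.
move=> ig.
have T_gt0 := twopi_gt0 R.
have bnd n t : 0 < t < T -> `|(1 - t / T) ^+ n| <= 1.
  move=> /andP[t0 tT]; rewrite normrX exprn_ile1// ler_norml.
  have h0 : 0 < t / T by rewrite divr_gt0.
  have h1 : t / T < 1 by rewrite ltr_pdivrMr// mul1r.
  by apply/andP; split; lra.
have mf n : measurable_fun `]0, T[ (fun t => (1 - t / T) ^+ n * g t).
  apply: measurable_funM; last by move/measurable_int/measurable_EFinP: ig.
  apply: measurable_funX; apply: measurable_funB => //.
  exact: measurable_funM.
pose f_ n t := ((1 - t / T) ^+ n * g t)%:E.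
have mf_ n : measurable_fun `]0, T[ (f_ n) by exact/measurable_EFinP.
have m0 : measurable_fun `]0, T[ (cst 0%E : R -> \bar R) by exact: measurable_cst.
have f_0 : {ae mu, forall t, `]0, T[%classic t -> f_ ^~ t @ \oo --> (cst 0%E : R -> \bar R) t}.
  apply: aeW => t /=; rewrite in_itv/= => /andP[t0 tT].
  apply/fine_cvgP; split; first by near=> n.
  rewrite /= -[X in _ --> X](mul0r (g t)); apply: cvgM; last exact: cvg_cst.
  apply: cvg_expr.
  have h0 : 0 < t / T by rewrite divr_gt0.
  have h1 : t / T < 1 by rewrite ltr_pdivrMr// mul1r.
  by rewrite ltr_norml; apply/andP; split; lra.
have iag : mu.-integrable `]0, T[ (fun t => `|(g t)%:E|%E) by exact: integrable_abse.
have f_g : {ae mu, forall t n, `]0, T[%classic t -> (`|f_ n t| <= `|(g t)%:E|)%E}.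
  apply: aeW => t n /=; rewrite in_itv/= => tT.
  by rewrite lee_fin normrM ler_piMl// bnd.
have [_ _] := @dominated_convergence _ _ R mu _ (measurable_itv _) f_ (cst 0%E) _ mf_ m0 f_0 iag f_g.
rewrite integral0 => h.
exact: (fine_cvg h).
Unshelve. all: by end_near. Qed.

(* Otherwise 1 = - i \int (1 - t / 2 pi)^n wave(t) K(t) dt for all n > 0, whereas
   the right-hand side tends to 0: this replaces the growth argument showing
   that Phi is not identically 0. *)
Lemma Phi_moment_rev_neq0 : exists n, Phi_moment (rev n) != 0.
Proof.
apply: contrapT => /forallNP nu_eq0.
have Tn0 : T != 0 by rewrite gt_eqF// twopi_gt0.
pose G t := wave lam t * K t.
have iG : cintegrable T G by exact: wK_cintegrable.
(* The real part of the vanishing moment, divided by the weight at 0. The positive index n + 1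
   removes the boundary term at 2 pi. *)
have one n : prim (fun t => (1 - t / T) ^+ n.+1 * complex.Im (G t)) T = 1.
  have c0 : taylor_weight n.+1 (0 : R) != 0.
    rewrite taylor_weight0; apply: mulf_neq0; first exact: expf_neq0.
    by rewrite invr_eq0 pnatr_eq0 -lt0n fact_gt0.
  have twE t : taylor_weight n.+1 t = taylor_weight n.+1 0 * (1 - t / T) ^+ n.+1.
    rewrite taylor_weight0 /taylor_weight mulrAC -exprMn mulrBr mulr1.
    by rewrite mulrCA divff// mulr1.
  have /negP := nu_eq0 n.+1; rewrite negbK Phi_moment_rev taylor_weightT mul0r subr0.
  rewrite mulf_eq0 pnatr_eq0 -[_ == 0%N]negbK -lt0n fact_gt0/=.
  move=> /eqP/(congr1 (@complex.Re R)); rewrite ReD ReM /= mul0r mul1r sub0r.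
  rewrite (@prim_eq_fct _ _ (fun t => taylor_weight n.+1 t * complex.Im (G t))).
    move=> /eqP; rewrite subr_eq0 => /eqP e.
    apply: (mulfI c0); rewrite mulr1 [RHS]e -RintegralZl//.
      by apply: prim_eq_fct => t _; rewrite mulrA -(twE t).
    apply: integrableM_continuous iG.2; apply: continuous_subspaceT.
    rewrite (_ : (fun t => _) = fun t => (taylor_weight n.+1 0)^-1 * taylor_weight n.+1 t).
      move=> t; apply: cvgM; first exact: cvg_cst.
      exact: continuous_taylor_weight.
    by apply/funext => t; rewrite (twE t) mulrA mulVf// mul1r.
  by move=> t _; rewrite ImM /= mul0r addr0.
have := prim_decay iG.2.
rewrite -cvg_shiftS (_ : (fun n => _) = fun=> 1); last first.
  by apply/funext => n; exact: one.
move=> h; have /eqP : (1 : R) = 0.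
  apply: (@cvg_unique _ _ ((fun=> 1 : R) @ \oo)) => //; exact: cvg_cst.
by rewrite oner_eq0.
Qed.

End MomentOrder.

(** * Derivatives of Phi *)

Section ExponentialRemainder.
Variable R : realType.
Local Notation mu := (@lebesgue_measure R).
Local Notation Re := (@complex.Re R).
Local Notation Im := (@complex.Im R).
Implicit Types (a b c x : R) (w z : R[i]).

Lemma mean_value_at0 (f df : R -> R) b :
  (forall x, is_derive x 1 f (df x)) ->
  exists2 c, `|c| <= `|b| & f b - f 0 = df c * b.
Proof.
move=> d.
have cf : continuous f by exact: is_derive_continuous d.
have [b0|b0] := leP 0 b.
  have [c + e] := MVT_segment b0 (fun x _ => d x) (continuous_subspaceT cf).
  rewrite in_itv/= => /andP[c0 cb]; exists c; last by rewrite e subr0.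
  by rewrite !ger0_norm.
have [c + e] := MVT_segment (ltW b0) (fun x _ => d x) (continuous_subspaceT cf).
rewrite in_itv/= => /andP[bc c0]; exists c.
  by rewrite !ler0_norm ?lerN2// ltW.
by rewrite -opprB e sub0r mulrN opprK.
Qed.

Lemma norm_sin_le x : `|sin x| <= `|x|.
Proof.
have [c _] := mean_value_at0 x (@is_derive_sin R).
rewrite sin0 subr0 => ->; rewrite normrM ler_piMl// cos_max//.
Qed.

Lemma norm_cosB1_le x : `|cos x - 1| <= x ^+ 2.
Proof.
have [c cx] := mean_value_at0 x (@is_derive_cos R).
rewrite cos0 => ->; rewrite -[x ^+ 2]real_normK ?num_real// normrM normrN expr2.
by rewrite ler_wpM2r// (le_trans (norm_sin_le _)).
Qed.

Lemma norm_cosB1_le' x : `|cos x - 1| <= `|x|.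
Proof.
have [c _] := mean_value_at0 x (@is_derive_cos R).
rewrite cos0 => ->; rewrite normrM normrN ler_piMl// sin_max//.
Qed.

Lemma norm_sinB_le x : `|sin x - x| <= x ^+ 2.
Proof.
have d (y : R) : is_derive y 1 (fun t => sin t - t) (cos y - 1).
  exact: is_deriveB.
have [c cx] := mean_value_at0 x d.
rewrite sin0 subrr subr0 => ->.
rewrite -[x ^+ 2]real_normK ?num_real// normrM expr2.
by rewrite ler_wpM2r// (le_trans (norm_cosB1_le' _)).
Qed.

Lemma norm_expRB1_le x : `|expR x - 1| <= `|x| * (1 + expR x).
Proof.
have h1 := expR_ge1Dx x; have h2 := expR_ge1Dx (- x).
have e0 := expR_gt0 x.
have h3 : expR x - 1 <= x * expR x.
  have := ler_wpM2r (ltW e0) h2; rewrite mulrC [X in _ <= X]mulrC.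
  by rewrite expRxMexpNx_1 => h; nra.
have [x0|x0] := leP 0 x.
  by rewrite !ger0_norm//; nra.
by rewrite (ltr0_norm x0) ler_norml; apply/andP; split; nra.
Qed.

Lemma norm_expRB1B_le x : `|expR x - 1 - x| <= x ^+ 2 * (1 + expR x).
Proof.
have h1 := expR_ge1Dx x; have h2 := expR_ge1Dx (- x).
have e0 := expR_gt0 x.
have h3 : expR x - 1 <= x * expR x.
  have := ler_wpM2r (ltW e0) h2; rewrite mulrC [X in _ <= X]mulrC.
  by rewrite expRxMexpNx_1 => h; nra.
have h4 : 0 <= expR x - 1 - x by lra.
rewrite ger0_norm//.
(* From e^x - 1 <= x e^x one gets 0 <= e^x - 1 - x <= x (e^x - 1), which reduces the claim to the
   first-order bound. *)
have : expR x - 1 - x <= `|x| * `|expR x - 1|.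
  rewrite -normrM (le_trans _ (ler_norm _))//; nra.
move=> /le_trans; apply.
rewrite -[x ^+ 2]real_normK ?num_real// expr2 -mulrA ler_wpM2l//.
exact: norm_expRB1_le.
Qed.

(** The components of the remainder produce four terms, each at most (1 + e^M) |w|^2; this is the
    origin of the 4. *)
Lemma cexp_remainder M w : normc w <= M ->
  normc (cexp w - 1 - w) <= 4 * (1 + expR M) * normc w ^+ 2.
Proof.
case: w => a b wM.
have aM : a <= M.
  by rewrite (le_trans (ler_norm _))// (le_trans (normr_Re_le (a +i* b))).
have eM : expR a <= expR M by rewrite ler_expR.
have e0 := expR_gt0 a.
apply: (le_trans (normc_le_ReIm _)).
rewrite sq_normc !ReImE /= oppr0 addr0.
have -> : expR a * cos b - 1 - a = expR a * (cos b - 1) + (expR a - 1 - a) by ring.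
have -> : expR a * sin b - b = expR a * (sin b - b) + b * (expR a - 1) by ring.
have h1 := norm_cosB1_le b.
have h2 := norm_sinB_le b.
have h3 := norm_expRB1_le a.
have h4 := norm_expRB1B_le a.
have r1 : `|expR a * (cos b - 1) + (expR a - 1 - a)| <=
    expR a * b ^+ 2 + a ^+ 2 * (1 + expR a).
  rewrite (le_trans (ler_normD _ _))// lerD// normrM (ger0_norm (ltW e0)).
  by rewrite ler_wpM2l// ltW.
have r2 : `|expR a * (sin b - b) + b * (expR a - 1)| <=
    expR a * b ^+ 2 + `|b| * (`|a| * (1 + expR a)).
  rewrite (le_trans (ler_normD _ _))// lerD//.
    by rewrite normrM (ger0_norm (ltW e0)) ler_wpM2l// ltW.
  by rewrite normrM ler_wpM2l.
apply: (le_trans (lerD r1 r2)).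
have ab : `|b| * `|a| <= a ^+ 2 + b ^+ 2.
  rewrite -[a ^+ 2]real_normK ?num_real// -[b ^+ 2]real_normK ?num_real//.
  by have := sqr_ge0 (`|a| - `|b|); have := normr_ge0 a; have := normr_ge0 b; nra.
have a2 := sqr_ge0 a; have b2 := sqr_ge0 b.
set A := a ^+ 2 in a2 ab *; set B := b ^+ 2 in b2 ab *.
have E1 : 0 <= 1 + expR a by lra.
have := ler_wpM2r E1 ab; rewrite mulrA => h5.
have : (A + B) * (1 + expR a) <= (A + B) * (1 + expR M).
  by rewrite ler_wpM2l ?addr_ge0// lerD2l.
have : expR a * B <= (1 + expR M) * (A + B).
  by apply: ler_pM => //; lra.
have : A * (1 + expR a) <= (1 + expR M) * (A + B).
  by rewrite mulrC; apply: ler_pM => //; lra.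
by lra.
Qed.

(** The real and imaginary parts of the integral are estimated separately by the same quantity,
    whence the factor 2. *)
Lemma normc_cprim_le S (f g : R -> R[i]) (B : R) : 0 <= S -> ccont S f ->
  cintegrable S g -> (forall t, 0 <= t <= S -> normc (f t) <= B) ->
  normc (cprim (fun t => f t * g t) S) <=
    B * (2 * prim (fun t => `|Re (g t)| + `|Im (g t)|) S).
Proof.
move=> S0 cf ig fB.
have [ir ii] := cintegrableM cf ig.
have [gr gi] := ig.
have iG : mu.-integrable `]0, S[ (EFin \o (fun t => `|Re (g t)| + `|Im (g t)|)).
  by apply: integrable_fctD => //; exact: integrable_norm.
have H (k : R -> R) : mu.-integrable `]0, S[ (EFin \o k) ->
    (forall t, 0 <= t <= S -> `|k t| <= B * (`|Re (g t)| + `|Im (g t)|)) ->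
    `|prim k S| <= B * prim (fun t => `|Re (g t)| + `|Im (g t)|) S.
  move=> ik kB; rewrite /prim.
  apply: (le_trans (le_normr_Rintegral _ ik)) => //.
  rewrite -RintegralZl//; apply: le_Rintegral => //.
  - exact: integrable_norm.
  - exact: integrable_fctZ.
  by move=> t /=; rewrite in_itv/= => /andP[t0 tS]; rewrite kB// !ltW.
have fr t : 0 <= t <= S -> `|Re (f t)| <= B.
  by move=> tS; rewrite (le_trans (normr_Re_le _))// fB.
have fi t : 0 <= t <= S -> `|Im (f t)| <= B.
  by move=> tS; rewrite (le_trans (normr_Im_le _))// fB.
apply: (le_trans (normc_le_ReIm _)).
rewrite mulrCA mulr_natl mulr2n lerD// /cprim /=; apply: H => // t tS.
  rewrite ReM (le_trans (ler_normB _ _))// mulrDr !normrM lerD//.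
    by rewrite ler_wpM2r// fr.
  by rewrite ler_wpM2r// fi.
rewrite ImM (le_trans (ler_normD _ _))// mulrDr !normrM addrC lerD//.
  by rewrite ler_wpM2r// fi.
by rewrite ler_wpM2r// fr.
Qed.

Lemma derive1_of_quadratic_remainder (f : R[i]^o -> R[i]^o) (z l : R[i]) (B : R) :
  (forall h : R[i], normc h <= 1 ->
    normc (f (z + h) - f z - h * l) <= B * normc h ^+ 2) ->
  (f^`())%classic z = l.
Proof.
move=> fB.
rewrite /derive1; apply: cvg_lim; first exact: norm_hausdorff.
apply/cvgrPdist_lt => -[e e']; rewrite ltcE/= => /andP[/eqP -> e0].
have B1 : 0 < `|B| + 1 by rewrite ltr_pwDr.
(* The minimum with 1 keeps h in the range of the remainder bound; |B| + 1 is a positive divisor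
   whatever the sign of [B]. *)
pose d := Num.min 1 (e / (`|B| + 1)).
have d0 : 0 < d by rewrite lt_min ltr01 divr_gt0.
have d0' : 0 < d%:C :> R[i] by rewrite ltcR.
near=> h.
have hn0 : h != 0 by near: h; rewrite near_withinE; apply: nearW => y; exact.
have : `|h| < d%:C by near: h; exact: (@dnbhs0_lt _ (R[i]^o)).
rewrite -[X in X < _]/((normc h)%:C) ltcR lt_min => /andP[h1 he].
rewrite -[X in X < _]/((normc (l - h^-1 * (f (h + z) - f z)))%:C).
rewrite -[X in _ < X]/(e%:C) ltcR.
have -> : l - h^-1 * (f (h + z) - f z) = - (h^-1 * (f (z + h) - f z - h * l)).
  rewrite [z + h]addrC [in RHS]mulrBr (mulrA h^-1 h) mulVf// mul1r.
  by rewrite opprB.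
rewrite normcN normcM normcV.
have nh : 0 < normc h.
  by rewrite -ltcR; rewrite -[X in _ < X]/(`|h|) normr_gt0.
rewrite ltr_pdivrMl//.
apply: (le_lt_trans (fB _ (ltW h1))).
move: he; rewrite ltr_pdivlMr// => he.
rewrite mulrC expr2 -mulrA ltr_pM2l//.
apply: le_lt_trans he; rewrite ler_wpM2l// ?(ltW nh)//.
by rewrite (le_trans (ler_norm B))// lerDl.
Unshelve. all: by end_near. Qed.

End ExponentialRemainder.

(** * Derivatives of Phi as moments *)

Section PhiDerivatives.
Variables (R : realType) (K : L2 R).
Local Notation mu := (@lebesgue_measure R).
Local Notation T := (2 * pi : R).
Implicit Types (z h : R[i]) (t : R).

Definition wave_remainder h t : R[i] := wave h t - 1 - 'i * h * t%:C.

Lemma waveD z h t : wave (z + h) t = wave z t * wave h t.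
Proof. by rewrite /wave mulrDr mulrDl cexpD. Qed.

Lemma id_ccont S : ccont S (fun t => t%:C : R[i]).
Proof.
split; last by move=> t; exact: cvg_cst.
by apply: continuous_subspaceT => t; exact: cvg_id.
Qed.

Lemma wave_remainder_ccont S h : ccont S (wave_remainder h).
Proof.
apply: (@eq_ccont _ _ (fun t => wave h t + (- 1 + (- ('i * h)) * t%:C))).
  by move=> t _; rewrite /wave_remainder; ring.
apply: ccontD; first exact: wave_ccont.
apply: ccontD; first exact: ccont_cst.
by apply: ccontM; [exact: ccont_cst|exact: id_ccont].
Qed.

(** The exponent i h t has modulus |h| t <= T, so the exponential remainder bound applies with M =
    T, uniformly in t. *)
Lemma wave_remainder_le h t : normc h <= 1 -> 0 <= t <= T ->
  normc (wave_remainder h t) <= (4 * (1 + expR T) * T ^+ 2) * normc h ^+ 2.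
Proof.
move=> h1 /andP[t0 tT].
have ni : normc ('i * h * t%:C : R[i]) = normc h * t.
  rewrite !normcM normc_real (ger0_norm t0).
  by rewrite /= expr0n expr1n add0r sqrtr1 mul1r.
have n0 : 0 <= normc h by case: (h) => a b; rewrite sqrtr_ge0.
have le : normc ('i * h * t%:C : R[i]) <= T.
  by rewrite ni -[X in _ <= X]mul1r ler_pM.
apply: (le_trans (cexp_remainder le)).
have c0 : 0 <= 4 * (1 + expR T) by rewrite mulr_ge0// addr_ge0// expR_ge0.
rewrite -[leRHS]mulrA ler_wpM2l// ni exprMn [leLHS]mulrC.
by rewrite ler_wpM2r ?sqr_ge0// ler_sqr ?nnegrE// twopi_ge0.
Qed.

Lemma ccont_normc_bounded S (f : R -> R[i]) : 0 <= S -> ccont S f ->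
  exists2 B, 0 <= B & forall t, 0 <= t <= S -> normc (f t) <= B.
Proof.
move=> S0 [fr fi].
have [A A0 fA] := within_continuous_bounded S0 fr.
have [B B0 fB] := within_continuous_bounded S0 fi.
exists (A + B); first exact: addr_ge0.
by move=> t tS; rewrite (le_trans (normc_le_ReIm _))// lerD ?fA ?fB.
Qed.

Lemma normc_i : normc 'i = 1 :> R.
Proof. by rewrite /= expr0n expr1n add0r sqrtr1. Qed.

Lemma normc_iX k : normc ('i ^+ k) = 1 :> R.
Proof.
by elim: k => [|k IH]; rewrite ?expr0 ?normc1// exprS normcM IH normc_i mulr1.
Qed.

Definition Phi_der k z : R[i] := 'i ^+ k * Phi_moment K z 'X^k.

Lemma Phi_der_remainder k z : exists B, forall h, normc h <= 1 ->
  normc (Phi_der k (z + h) - Phi_der k z - h * Phi_der k.+1 z) <=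
    B * normc h ^+ 2.
Proof.
pose p t : R[i] := t%:C ^+ k * wave z t.
have cp : ccont T p.
  apply: (@eq_ccont _ _ (fun t => ('X^k).[t%:C] * wave z t)).
    by move=> t _; rewrite hornerXn.
  by apply: ccontM; [exact: horner_ccont|exact: wave_ccont].
have [B B0 pB] := ccont_normc_bounded (twopi_ge0 R) cp.
pose Cr : R := 4 * (1 + expR T) * T ^+ 2.
pose M : R := 2 * prim (fun t => `|complex.Re (K t)| + `|complex.Im (K t)|) T.
(* The first summand bounds the boundary term at 2 pi, the second the integral against [K]. *)
exists (B * Cr + B * Cr * M) => h h1.
have TT : 0 <= T <= T by rewrite lexx twopi_ge0.
have cpr : ccont T (fun t => p t * wave_remainder h t).
  by apply: ccontM => //; exact: wave_remainder_ccont.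
have prB t : 0 <= t <= T -> normc (p t * wave_remainder h t) <=
    B * Cr * normc h ^+ 2.
  move=> tT; rewrite normcM -mulrA ler_pM ?pB//.
  - by case: (p t) => a b; rewrite sqrtr_ge0.
  - by case: (wave_remainder h t) => a b; rewrite sqrtr_ge0.
  - exact: wave_remainder_le.
have nu_cint j w : cintegrable T (fun t => ('X^j : {poly R[i]}).[t%:C] * (wave w t * K t)).
  apply: cintegrableM; first exact: horner_ccont.
  exact: wK_cintegrable.
(* Since wave (z + h) = wave z wave h, the increment is the functional applied to t^k wave z times
   the remainder of wave h. The evaluations at 0 cancel: that of 'X^k does not depend on z, and
   'X^(k+1) vanishes at 0. *)
have -> : Phi_der k (z + h) - Phi_der k z - h * Phi_der k.+1 z =
    'i ^+ k * (- (p T * wave_remainder h T) +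
      'i * cprim (fun t => (p t * wave_remainder h t) * K t) T).
  rewrite /Phi_der exprSr.
  have -> : cprim (fun t => (p t * wave_remainder h t) * K t) T =
      cprim (fun t => ('X^k : {poly R[i]}).[t%:C] * (wave (z + h) t * K t)) T
      - cprim (fun t => ('X^k : {poly R[i]}).[t%:C] * (wave z t * K t)) T
      - 'i * h * cprim (fun t => ('X^(k.+1) : {poly R[i]}).[t%:C] * (wave z t * K t)) T.
    have i1 := nu_cint k (z + h).
    have i2 := cintegrableZ (- 1) (nu_cint k z).
    have i3 := cintegrableZ (- ('i * h)) (nu_cint k.+1 z).
    rewrite -mulNr -(cprimZ (- ('i * h)) (nu_cint k.+1 z)).
    rewrite -[X in _ = _ + X + _]mulN1r -(cprimZ (- 1) (nu_cint k z)).
    rewrite -(cprimD i1 i2) -(cprimD (cintegrableD i1 i2) i3).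
    apply: eq_cprim => t _.
    by rewrite !hornerXn waveD /p /wave_remainder exprS; ring.
  rewrite /Phi_moment !hornerXn waveD /p /wave_remainder !(exprS _ k).
  set c1 := cprim _ _; set c2 := cprim _ _; set c3 := cprim _ _.
  set a := 'i ^+ k.
  by ring.
rewrite normcM normc_iX mul1r [leRHS]mulrDl.
apply: le_trans (le_normcD _ _) _; rewrite normcN lerD ?prB//.
rewrite normcM normc_i mul1r.
apply: le_trans (normc_cprim_le (twopi_ge0 R) cpr (L2_cintegrable K) prB) _.
by rewrite -/M [leRHS]mulrAC.
Qed.

Lemma Phi_der0 : Phi_der 0 = Phi K.
Proof.
apply/funext => z; rewrite /Phi_der expr0 mul1r /Phi_moment expr0 !hornerC mul1r /Phi.
congr (_ - _ + _).
  by rewrite /wave [_ * 'i]mulrC mulrAC.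
rewrite -mulN1r -[cintegral _]/(cprim _ T).
rewrite -!cprimZ.
- by apply: eq_cprim => t _; rewrite hornerC /wave; ring.
- apply: cintegrableM; first exact: (wave_ccont z).
  exact/cintegrableZ/L2_cintegrable.
- by apply: cintegrableM; [exact: horner_ccont|exact: wK_cintegrable].
Qed.

Lemma derive1n_Phi k : ((Phi K)^`(k))%classic = Phi_der k.
Proof.
elim: k => [|k IH]; first by rewrite derive1n0 Phi_der0.
rewrite derive1nS IH; apply/funext => z.
have [B H] := Phi_der_remainder k z.
exact: derive1_of_quadratic_remainder H.
Qed.

End PhiDerivatives.

Theorem theorem3p6 (R : realType) (K : L2 R) (lambda : R[i])
    (hlambda : spectrum (P1 K) lambda) :
  exists m : nat,
    alg_multiplicity_is (P1 K) lambda m /\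
    root_multiplicity_is (Phi K) lambda m.
Proof.
(* The reversed powers link the two multiplicities: their moments are the chain defects up to
   nonzero factors, and triangularity passes from them to the derivatives of Phi. *)
have [m nz low] := ex_minnP (Phi_moment_rev_neq0 K lambda).
have rev0 j : (j < m)%N -> Phi_moment K lambda (((2 * pi)%:C%:P - 'X) ^+ j) = 0.
  move=> jm; apply/eqP/negPn/negP => /low.
  by rewrite leqNgt jm.
have [low' top] := Phi_moment_monomials rev0.
have i0 : 'i != 0 :> R[i] by rewrite eq_complex/= oner_eq0 andbF.
have f0 j : j`!%:R != 0 :> R[i] by rewrite pnatr_eq0 -lt0n fact_gt0.
exists m; split.
  apply: alg_multiplicity_of_chain => [j jm|].
    apply/eqP; have := chain_defectE K lambda j.
    by rewrite rev0// mulr0 => /eqP; rewrite mulf_eq0 (negbTE (f0 j)).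
  apply/eqP => d0; have := chain_defectE K lambda m.
  rewrite d0 mulr0 => /esym/eqP; apply/negP.
  by rewrite mulf_neq0// expf_neq0// oppr_eq0.
split=> [k km|].
  by rewrite derive1n_Phi /Phi_der low'// mulr0.
rewrite derive1n_Phi /Phi_der top.
by rewrite !mulf_neq0// ?expf_neq0// oppr_eq0 oner_eq0.
Qed.
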